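(* Let $n\ge 3$, let $1\le p<\infty$ and $\frac1p+\frac1q=1$, and let $\gamma\in\mathbf{R}$ satisfy $$-(n-1)(p-1)<\gamma<(n-1)+p \quad\text{if } p>1;\qquad 0<\gamma\le n\quad\text{if } p=1.$$ Let $0<\alpha<2$. Let $f$ be a measurable function on $\mathbf{R}^{n-1}$ satisfying $$\int_{\mathbf{R}^{n-1}}\frac{|f(y')|^p}{(1+|y'|)^{\gamma}}\,dy'<\infty,$$ and let $\mu$ be a positive Borel measure on $H$ satisfying $$\int_H\frac{y_n^p}{(1+|y|)^\gamma}\,d\mu(y)<\infty\qquad\text{and}\qquad \int_H\frac{1}{(1+|y|)^{n-1}}\,d\mu(y)<\infty.$$ Consider the subharmonic function $$u(x)=v(x)+h(x),\qquad x\in H,$$ where $$v(x)=\int_{\mathbf{R}^{n-1}}P(x,y')f(y')\,dy',\qquad h(x)=\int_H G(x,y)\,d\mu(y).$$ Then there exist an at most countable (finite or infinite) family of points $x_j\in H$ and radii $\rho_j>0$, $j=1,2,\dots$, such that $$\sum_{j}\frac{\rho_j^{pn-\alpha}}{|x_j|^{pn-\alpha}}<\infty$$ and, with $\mathcal{G}=\bigcup_{j}B(x_j,\rho_j)$, $$u(x)=o\left(x_n^{1-\frac{\alpha}{p}}|x|^{\frac{\gamma}{p}+\frac{n-1}{q}-n+\frac{\alpha}{p}}\right)\quad\text{as } |x|\to\infty,\ x\in H\setminus \mathcal{G}.$$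
   Context: Points of $\mathbf{R}^n$ are written $x=(x',x_n)$ with $x'\in\mathbf{R}^{n-1}$, $x_n\in\mathbf{R}$; $|\cdot|$ is the Euclidean norm. $H=\{x=(x',x_n)\in\mathbf{R}^n: x_n>0\}$ is the upper half space, with boundary identified with $\mathbf{R}^{n-1}$ (i.e. with $\mathbf{R}^{n-1}\times\{0\}$). $B(x,\rho)$ is the open ball in $\mathbf{R}^n$ of center $x$ and radius $\rho$. Let $\omega_n=\frac{2\pi^{n/2}}{\Gamma(n/2)}$ be the surface area of the unit sphere in $\mathbf{R}^n$, $r_n=\frac{1}{(n-2)\omega_n}$, and $E(x)=-r_n|x|^{2-n}$ for $x\in\mathbf{R}^n\setminus\{0\}$. The Green function of $H$ is (with this sign convention, so that $G\le 0$) $$G(x,y)=E(x-y)-E(x-y^{\ast}),\qquad x,y\in\overline{H},\ x\ne y,$$ where $y^{\ast}=(y_1,\dots,y_{n-1},-y_n)$. The Poisson kernel of $H$ is $$P(x,y')=\frac{2x_n}{\omega_n|x-(y',0)|^n},\qquad x\in H,\ y'\in\mathbf{R}^{n-1}.$$ When $p=1$ one has $q=\infty$ and $\frac{n-1}{q}$ is read as $0$. The function $h$ (hence $u$) may take the value $-\infty$ at some points; $G(x,x)$ is read as $-\infty$. The statement $u(x)=o(g(x))$ as $|x|\to\infty$, $x\in H\setminus \mathcal{G}$, means: for every $\varepsilon>0$ there is $R>0$ such that $|u(x)|\le\varepsilon g(x)$ for all $x\in H\setminus \mathcal{G}$ with $|x|\ge R$. *)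

(* Defs.v *)
From HB Require Import structures.
From mathcomp Require Import all_boot all_order all_algebra.
From mathcomp Require Import all_classical all_reals all_analysis.
From mathcomp Require Import measurable_realfun.

Set Implicit Arguments.
Unset Strict Implicit.
Unset Printing Implicit Defensive.
Import Order.TTheory GRing.Theory Num.Theory.
Import numFieldNormedType.Exports.

Local Open Scope classical_set_scope.
Local Open Scope ring_scope.

(** R^m is [m.-tuple R]: its library sigma-algebra, generated by the
    coordinates, is the Borel one. Lebesgue measure on R^(m+1) is the image
    under [tcons] of the product of the Lebesgue measures on R and R^m. *)

Definition tcons (R : realType) (m : nat) (z : R * m.-tuple R) :
  m.+1.-tuple R := [the m.+1.-tuple R of z.1 :: z.2].

Lemma measurable_tcons (R : realType) (m : nat) :
  measurable_fun [set: R * m.-tuple R] (@tcons R m).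
Proof. exact: measurable_cons. Qed.

Section lebesgue_step.
Context (R : realType) (m : nat).
Variable mu : {sigma_finite_measure set (m.-tuple R) -> \bar R}.

Definition lebesgue_step : set (m.+1.-tuple R) -> \bar R :=
  pushforward (@lebesgue_measure R \x mu)%E (@tcons R m).

Let measurable_pre (A : set (m.+1.-tuple R)) :
  measurable A -> measurable (@tcons R m @^-1` A).
Proof. by move=> mA; rewrite -[X in measurable X]setTI; exact: measurable_tcons. Qed.

Let step0 : lebesgue_step set0 = 0%E.
Proof. by rewrite /lebesgue_step /pushforward preimage_set0 measure0. Qed.

Let step_ge0 A : (0 <= lebesgue_step A)%E.
Proof. by rewrite /lebesgue_step /pushforward measure_ge0. Qed.

Let step_sigma_additive : semi_sigma_additive lebesgue_step.
Proof.
move=> F mF tF mUF; rewrite /lebesgue_step /pushforward preimage_bigcup.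
apply: measure_semi_sigma_additive.
- by move=> i; exact: measurable_pre.
- apply/trivIsetP => /= i j _ _ ij; rewrite -preimage_setI.
  by move/trivIsetP : tF => /(_ _ _ _ _ ij) ->//; rewrite preimage_set0.
- by rewrite -preimage_bigcup; exact: measurable_pre.
Qed.

HB.instance Definition _ := isMeasure.Build _ _ _ lebesgue_step
  step0 step_ge0 step_sigma_additive.

Let step_sigma_finite : sigma_finite setT lebesgue_step.
Proof.
have /sigma_finiteP[F [TF ndF Foo]] := sigma_finiteT (@lebesgue_measure R).
have /sigma_finiteP[G [TG ndG Goo]] := sigma_finiteT mu.
pose g (t : m.+1.-tuple R) : R * m.-tuple R :=
  (thead t, [tuple of behead t]).
have mg : measurable_fun setT g.
  by apply/measurable_fun_pairP; split;
    [exact: measurable_tnth|exact: measurable_behead].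
have tconsK : cancel (@tcons R m) g.
  by case=> a s; rewrite /g /tcons theadE; congr pair; exact/val_inj.
exists (fun k => g @^-1` (F k `*` G k)).
  apply/seteqP; split=> // t _.
  have [i _ Fi] : (\bigcup_i F i) (g t).1 by rewrite -TF.
  have [j _ Gj] : (\bigcup_i G i) (g t).2 by rewrite -TG.
  exists (maxn i j) => //; split.
  - by move: Fi; exact/subsetPset/ndF/leq_maxl.
  - by move: Gj; exact/subsetPset/ndG/leq_maxr.
move=> k; have [mFk Fkoo] := Foo k; have [mGk Gkoo] := Goo k; split.
  by rewrite -[X in measurable X]setTI; apply: mg => //; exact: measurableX.
rewrite /lebesgue_step /pushforward -comp_preimage.
rewrite (_ : g \o @tcons R m = idfun) ?preimage_id; last first.
  by apply/funext => z /=; rewrite tconsK.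
by rewrite product_measure1E// lte_mul_pinfty// ge0_fin_numE.
Qed.

HB.instance Definition _ := Measure_isSigmaFinite.Build _ _ _ lebesgue_step
  step_sigma_finite.

End lebesgue_step.

Fixpoint lebesgue (R : realType) (m : nat) :
    {sigma_finite_measure set (m.-tuple R) -> \bar R} :=
  if m is k.+1 then lebesgue_step (lebesgue R k) else \d_[tuple].

(** Lebesgue measurability, i.e. measurability with respect to the completion
    of the Borel sigma-algebra. The library integral is [sup] of the integrals of the Borel simple functions
    below the positive part, minus the same for the negative part; on such an
    [f] it is the integral against the completed measure. *)
Definition lebesgue_measurable (R : realType) (m : nat) (f : m.-tuple R -> R) :=
  forall B : set R, measurable B ->
    completed_algebra_gen (lebesgue R m) (f @^-1` B).

(** A point [(x', x_n)] of R^n is literally a pair, with [x'] in R^(n-1);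
    its sigma-algebra is the product one. Intended for [1 <= n]. *)

Notation bdry R n := (n.-1.-tuple R) (only parsing).
Notation space R n := (n.-1.-tuple R * R)%type (only parsing).

Section HalfSpace.
Context (R : realType) (n : nat).
Implicit Types x y : space R n.

Definition bnorm (x' : bdry R n) : R :=
  Num.sqrt (\sum_(i < n.-1) tnth x' i ^+ 2).

Definition enorm x : R := Num.sqrt (\sum_(i < n.-1) tnth x.1 i ^+ 2 + x.2 ^+ 2).

Definition vsub x y : space R n :=
  ([tuple tnth x.1 i - tnth y.1 i | i < n.-1], x.2 - y.2).

Definition eball x (r : R) : set (space R n) := [set y | enorm (vsub y x) < r].

Definition halfspace : set (space R n) := [set x | 0 < x.2].

Definition reflection y : space R n := (y.1, - y.2).

Definition gamma_fun (s : R) : R :=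
  \int[@lebesgue_measure R]_(t in `]0, +oo[) (t `^ (s - 1) * expR (- t)).

(** Surface area of the unit sphere of R^n. *)
Definition omega : R := 2 * pi `^ (n%:R / 2) / gamma_fun (n%:R / 2).

Definition rconst : R := ((n%:R - 2) * omega)^-1.

(** Only meaningful for [x] different from the origin. *)
Definition fundamental x : R := - rconst * enorm x `^ (2 - n%:R).

Definition green x y : \bar R :=
  if x == y then -oo%E
  else (fundamental (vsub x y) - fundamental (vsub x (reflection y)))%:E.

Definition poisson x (y' : bdry R n) : R :=
  2 * x.2 / (omega * enorm (vsub x (y', 0)) ^+ n).

Definition poisson_integral (f : bdry R n -> R) x : \bar R :=
  (\int[lebesgue R n.-1]_y' (poisson x y' * f y')%:E)%E.

Definition green_potential (mu : {measure set (space R n) -> \bar R}) x :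
    \bar R :=
  (\int[mu]_(y in halfspace) green x y)%E.

End HalfSpace.

Arguments halfspace : clear implicits.

(* Main.v *)
From HB Require Import structures.
Require Import Defs.
From mathcomp Require Import all_boot all_order all_algebra.
From mathcomp Require Import all_classical all_reals all_analysis.
From mathcomp Require Import measurable_realfun ring lra.
Import Order.TTheory GRing.Theory Num.Theory.
Import numFieldNormedType.Exports.

(** Write [s = |x|], [r = 1 + |y|], [d = |x - y|] and [N = p n - alpha].

    Up to constants, the Poisson kernel at [(x, y')] and the Green function at
    [(x, y)] divided by [y_n] are bounded by one kernel, [halfspace_kernel],
    which is [x_n^(-1) d^(2-n)] for [d <= x_n] and [x_n d^(-n)] beyond
    ([poisson_kernel], [green_le_kernel]). Both [v] and [h] are thus dominated
    by potentials [int K(x, y) F(y) dnu(y)]: on the boundary with [F] a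
    measurable substitute for [|f|] and Lebesgue measure, inside with
    [F(y) = y_n] and [mu]. In both cases the energy, that is the integral of
    [phi = F^p / r^gamma], is finite, and the mass of the ball of radius [r] is
    [O(r^(n-1))].

    Such a potential is estimated by the pointwise inequality
    [K F <= delta + delta^(1-p) (K F)^p] ([le_add_powR]), which plays the role
    of Hoelder's inequality and does not distinguish [p = 1]. Take
    [delta = tau g(x) s^(1-n) w(r / s)], where [w] is a power [-b1] below [1]
    and [-b3] above, with [b1 < n - 1 < b3]. Then [int delta dnu] is
    [O(tau g(x))], and the second term is [tau^(1-p) g(x)] times the integral
    of [phi] against an explicit weight. Where [d >= s / 2] this weight is
    bounded, and tends to zero for fixed [y] as [s] grows ([weight_far],
    [integral_decay]). Where [d < s / 2] it is at most a multiple of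
    [(s / x_n)^N] times a function of [d / x_n] which is a power
    [-(n - 2) p] below [1] and [- n p] above ([weight_near]). Since
    [(n - 2) p < N < n p], that is [0 < alpha < 2 p], dyadic summation
    ([integral_bipower]) bounds its integral by [e] as soon as every ball
    [B(x, r)] with [r <= s / 2] has energy at most a constant times
    [e (r / s)^N] ([potential_estimate]).

    This last condition fails only on an exceptional set, which is covered by a
    Vitali argument: relative radii [r / s] are selected greedily, the selected
    balls are disjoint, and the sum of their [(r / s)^N] is at most the total
    energy ([sparse_off_balls]). Applying this to a measure that is finite and
    yet infinitely larger than the energy at infinity gives a constant [e] that
    tends to zero ([vanishing_off_balls]), hence the little-o. One family of
    balls serves for [v] and [h], as the two energies are first added up. *)

Set Implicit Arguments.
Unset Strict Implicit.
Unset Printing Implicit Defensive.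
Local Open Scope classical_set_scope.
Local Open Scope ring_scope.

Notation point R n := (n.-1.-tuple R * R)%type (only parsing).

(** * Euclidean distance *)

Lemma measurable_sublevel d (T : measurableType d) (R : realType) (u : T -> R)
  (r : R) : measurable_fun [set: T] u -> measurable [set t | u t < r].
Proof.
move=> mu; rewrite -[X in measurable X]setTI.
rewrite (_ : [set t | _] = u @^-1` `]-oo, r[); first exact: mu.
by apply/seteqP; split=> t /=; rewrite in_itv.
Qed.

Section minkowski.
Context (R : rcfType) (I : finType).
Implicit Types a b : I -> R.

Lemma cauchy_schwarz_sum a b :
  \sum_i a i * b i <= Num.sqrt (\sum_i a i ^+ 2) * Num.sqrt (\sum_i b i ^+ 2).
Proof.
set A := \sum_i a i ^+ 2; set B := \sum_i b i ^+ 2; set S := \sum_i a i * b i.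
have A0 : 0 <= A by apply: sumr_ge0 => i _; exact: sqr_ge0.
have B0 : 0 <= B by apply: sumr_ge0 => i _; exact: sqr_ge0.
rewrite -sqrtrM//; apply: le_trans (ler_norm _) _.
rewrite -sqrtr_sqr ler_wsqrtr//.
have quad t : 0 <= A + 2 * t * S + t ^+ 2 * B.
  suff -> : A + 2 * t * S + t ^+ 2 * B = \sum_i (a i + t * b i) ^+ 2.
    by apply: sumr_ge0 => i _; exact: sqr_ge0.
  rewrite /A /S /B !mulr_sumr -!big_split/=; apply: eq_bigr => i _; ring.
have [B00|B00] := eqVneq B 0.
  suff -> : S = 0 by rewrite expr0n/= mulr_ge0.
  rewrite /S big1// => i _.
  have : b i ^+ 2 = 0.
    apply/eqP; move/eqP: B00; rewrite psumr_eq0 => [/allP/(_ i)|j _].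
      by rewrite mem_index_enum => /(_ isT).
    exact: sqr_ge0.
  by move/eqP; rewrite sqrf_eq0 => /eqP ->; rewrite mulr0.
have Bp : 0 < B by rewrite lt_def B00.
have := quad (- S / B).
have -> : A + 2 * (- S / B) * S + (- S / B) ^+ 2 * B = (A * B - S ^+ 2) / B.
  by field; rewrite B00.
by rewrite pmulr_lge0 ?invr_gt0// subr_ge0.
Qed.

Lemma minkowski_sum a b :
  Num.sqrt (\sum_i (a i + b i) ^+ 2) <=
  Num.sqrt (\sum_i a i ^+ 2) + Num.sqrt (\sum_i b i ^+ 2).
Proof.
have A0 : 0 <= \sum_i a i ^+ 2 by apply: sumr_ge0 => i _; exact: sqr_ge0.
have B0 : 0 <= \sum_i b i ^+ 2 by apply: sumr_ge0 => i _; exact: sqr_ge0.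
have AB0 : 0 <= Num.sqrt (\sum_i a i ^+ 2) + Num.sqrt (\sum_i b i ^+ 2).
  by rewrite addr_ge0// sqrtr_ge0.
rewrite -(ger0_norm AB0) -sqrtr_sqr ler_wsqrtr// sqrrD !sqr_sqrtr//.
have -> : \sum_i (a i + b i) ^+ 2 =
    \sum_i a i ^+ 2 + (\sum_i a i * b i) *+ 2 + \sum_i b i ^+ 2.
  by rewrite -sumrMnl -!big_split/=; apply: eq_bigr => i _; rewrite sqrrD.
by rewrite lerD2r lerD2l lerMn2r/= cauchy_schwarz_sum.
Qed.

End minkowski.

Section euclid.
Context (R : realType) (n : nat).
Implicit Types x y z : point R n.

Definition dist x y : R := enorm (vsub x y).

(** All [n] coordinates on the same footing, so that Minkowski's inequality for
    finite sums applies to the whole norm. *)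
Let coord x (i : 'I_n.-1.+1) : R := nth 0 (rcons x.1 x.2) i.

Let enorm_coord x : enorm x = Num.sqrt (\sum_i coord x i ^+ 2).
Proof.
rewrite /enorm big_ord_recr/= /coord; congr (Num.sqrt (_ + _)).
  apply: eq_bigr => i _; rewrite nth_rcons/= size_tuple ltn_ord.
  by rewrite (tnth_nth 0).
by rewrite nth_rcons/= size_tuple ltnn eqxx.
Qed.

Let coord_vsub x y i : coord (vsub x y) i = coord x i - coord y i.
Proof.
rewrite /coord !nth_rcons !size_tuple /vsub.
case: (ltnP i n.-1) => [li|_]; last by case: eqP => _; rewrite ?subr0.
have nthE (t : n.-1.-tuple R) : nth 0 t i = tnth t (Ordinal li).
  by rewrite (tnth_nth 0).
by rewrite !nthE/= tnth_mktuple.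
Qed.

Lemma enorm_ge0 x : 0 <= enorm x.
Proof. exact: sqrtr_ge0. Qed.

Lemma dist_ge0 x y : 0 <= dist x y.
Proof. exact: sqrtr_ge0. Qed.

Lemma dist_sym x y : dist x y = dist y x.
Proof.
rewrite /dist !enorm_coord; congr Num.sqrt; apply: eq_bigr => i _.
by rewrite !coord_vsub -sqrrN opprB.
Qed.

Lemma dist_triangle z x y : dist x y <= dist x z + dist z y.
Proof.
rewrite /dist !enorm_coord.
apply: le_trans (minkowski_sum _ _); rewrite ler_wsqrtr//.
apply: ler_sum => i _; rewrite !coord_vsub.
by rewrite (_ : _ - _ = coord x i - coord z i + (coord z i - coord y i)) //; ring.
Qed.

Lemma enorm_le_dist x y : enorm x <= dist x y + enorm y.
Proof.
rewrite /dist !enorm_coord; apply: le_trans (minkowski_sum _ _).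
by rewrite ler_wsqrtr//; apply: ler_sum => i _; rewrite coord_vsub subrK.
Qed.

Let coord_le_enorm x i : `|coord x i| <= enorm x.
Proof.
rewrite enorm_coord -sqrtr_sqr ler_wsqrtr// (bigD1 i)//= lerDl.
by apply: sumr_ge0 => j _; exact: sqr_ge0.
Qed.

Lemma height_le_enorm x : `|x.2| <= enorm x.
Proof.
have := coord_le_enorm x ord_max.
by rewrite /coord nth_rcons size_tuple ltnn eqxx.
Qed.

Lemma height_le_dist x y : `|x.2 - y.2| <= dist x y.
Proof. exact: (height_le_enorm (vsub x y)). Qed.

Lemma dist_eq0 x y : dist x y = 0 -> x = y.
Proof.
move=> d0; have e i : coord x i = coord y i.
  apply/eqP; rewrite -subr_eq0 -coord_vsub -normr_le0.
  by rewrite -d0 coord_le_enorm.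
case: x y e {d0} => [x a] [y b] e; congr (_, _).
  apply: eq_from_tnth => i; have := e (widen_ord (leqnSn _) i).
  by rewrite /coord !nth_rcons !size_tuple/= ltn_ord !(tnth_nth 0).
by have := e ord_max; rewrite /coord !nth_rcons !size_tuple ltnn eqxx.
Qed.

Lemma distxx x : dist x x = 0.
Proof.
rewrite /dist enorm_coord big1 ?sqrtr0// => i _.
by rewrite coord_vsub subrr expr0n.
Qed.

(** The algebraic identity behind the decay of the Green function. *)
Lemma dist_reflection x y :
  dist x (reflection y) ^+ 2 = dist x y ^+ 2 + 4 * x.2 * y.2.
Proof.
have s0 z : 0 <= \sum_(i < n.-1) tnth z.1 i ^+ 2 + (z : point R n).2 ^+ 2.
  by rewrite addr_ge0 ?sqr_ge0// sumr_ge0// => i _; exact: sqr_ge0.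
rewrite /dist /enorm !sqr_sqrtr// /vsub /reflection/=; ring.
Qed.

Lemma enorm_bdry (y' : bdry R n) : enorm (y', 0) = bnorm y'.
Proof. by rewrite /enorm/= expr0n addr0. Qed.

Lemma measurable_dist x : measurable_fun [set: point R n] (dist x).
Proof.
apply: (measurableT_comp (f := @Num.sqrt R)); first exact: continuous_measurable_fun (@sqrt_continuous R).
rewrite /=; apply: measurable_funD.
  under eq_fun do under eq_bigr do rewrite tnth_mktuple.
  apply: measurable_sum => i; apply: measurable_funX.
  apply: measurable_funB => //.
  by apply: (measurableT_comp (measurable_tnth i)); exact: measurable_fst.
by apply: measurable_funX; apply: measurable_funB => //; exact: measurable_snd.
Qed.

Lemma measurable_enorm : measurable_fun [set: point R n] (@enorm R n).
Proof.
apply: (measurableT_comp (f := @Num.sqrt R)); first exact: continuous_measurable_fun (@sqrt_continuous R).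
apply: measurable_funD.
  apply: measurable_sum => i; apply: measurable_funX.
  by apply: (measurableT_comp (measurable_tnth i)); exact: measurable_fst.
by apply: measurable_funX; exact: measurable_snd.
Qed.

Lemma eballE x r : eball x r = [set y | dist x y < r].
Proof. by apply/seteqP; split=> y; rewrite /eball /= -/(dist y x) dist_sym. Qed.

Lemma measurable_eball x r : measurable (@eball R n x r).
Proof.
by rewrite eballE; exact: measurable_sublevel (measurable_dist x).
Qed.

Lemma measurable_halfspace : measurable (halfspace R n).
Proof.
rewrite -[X in measurable X]setTI (_ : halfspace _ _ = snd @^-1` `]0, +oo[).
  exact: measurable_snd.
by apply/seteqP; split=> y /=; rewrite in_itv/= andbT.
Qed.

Lemma measurable_point x : measurable [set x].
Proof.
rewrite -[X in measurable X]setTI (_ : [set x] = dist x @^-1` `]-oo, 0]).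
  exact: measurable_dist.
apply/seteqP; split=> y /=; rewrite in_itv/=; first by move=> ->; rewrite distxx.
move=> d0; apply/esym/dist_eq0/eqP; by rewrite eq_le d0 dist_ge0.
Qed.

End euclid.

(** * Dyadic summation *)

Section dyadic.
Context (R : realType).

(** The profile of the kernel and of the auxiliary weights: one power of the
    distance below the natural length scale, another one above it. *)
Definition bipower (a b u : R) : R := if u <= 1 then u `^ (- a) else u `^ (- b).

Lemma bipower_ge0 a b u : 0 <= bipower a b u.
Proof. by rewrite /bipower; case: ifP => _; exact: powR_ge0. Qed.

Lemma measurable_bipower a b : measurable_fun [set: R] (bipower a b).
Proof.
apply: measurable_fun_ifT; last 2 first.
- exact: measurable_powR.
- exact: measurable_powR.
exact: measurable_fun_ler.
Qed.

Section cover.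
Context d (T : measurableType d) (nu : {measure set T -> \bar R}).
Variables (D : set T) (phi u : T -> R).
Hypotheses (mD : measurable D) (mphi : measurable_fun [set: T] phi)
  (mu : measurable_fun [set: T] u) (phi0 : forall t, 0 <= phi t).

Let msub r : measurable [set t | u t < r] := measurable_sublevel r mu.

(** Bounding [k] by [c i] on the sublevel set of height [rho i] turns the
    growth of [phi] on sublevel sets into a geometric series. *)
Lemma integral_sublevel_series (k : R -> R) (c rho : nat -> R) (A B q N : R) :
  measurable_fun [set: R] k -> (forall v, 0 <= k v) -> (forall i, 0 <= c i) ->
  (forall i, 0 < rho i) -> 0 <= A -> 0 <= B -> 0 < q < 1 ->
  (forall t, D t -> exists2 i, u t < rho i & k (u t) <= c i) ->
  (forall r, 0 < r ->
    (\int[nu]_(t in D `&` [set t | (u t < r)%R]) (phi t)%:E <=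
     (A * r `^ N)%:E)%E) ->
  (forall i, c i * rho i `^ N <= B * q ^+ i) ->
  (\int[nu]_(t in D) (phi t * k (u t))%:E <= (A * (B / (1 - q)))%:E)%E.
Proof.
move=> mk k0 c0 rho0 A0 B0 /andP[q0 q1] cov grow geo.
pose h i t := ((c i)%:E * ((EFin \o phi) \_ [set t | (u t < rho i)%R]) t)%E.
have h0 i t : (0 <= h i t)%E.
  apply: mule_ge0; first by rewrite lee_fin.
  by rewrite patchE; case: ifP => // _ /=; rewrite lee_fin.
have mpat i : measurable_fun D ((EFin \o phi) \_ [set t | u t < rho i]).
  apply: measurable_funTS; apply/(measurable_restrictT _ _).1 => //.
  by apply: measurable_funTS; exact/measurable_EFinP.
have mh i : measurable_fun D (h i) by exact: measurable_funeM.
have -> : A * (B / (1 - q)) = (A * B) / (1 - q) by rewrite mulrA.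
apply: (@le_trans _ _ (\int[nu]_(t in D) \sum_(i <oo) h i t)%E).
  apply: ge0_le_integral => //.
  - by move=> t _; rewrite lee_fin mulr_ge0.
  - apply/measurable_EFinP; apply: measurable_funTS; apply: measurable_funM => //.
    exact: measurableT_comp.
  - by apply: ge0_emeasurable_sum => // i t _ _; exact: h0.
  - move=> t Dt; have [i ui ki] := cov t Dt.
    apply: (@le_trans _ _ (h i t)).
      rewrite /h patchE mem_set//= -EFinM lee_fin mulrC.
      by rewrite ler_wpM2r.
    apply: le_trans (nneseries_lim_ge (i.+1) _) => //.
    by rewrite big_nat_recr//= leeDr// sume_ge0.
rewrite integral_nneseries//.
apply: lime_le.
  by apply: is_cvg_nneseries => i _ _; exact: integral_ge0.
near=> m; rewrite /=.
apply: (@le_trans _ _ (\sum_(0 <= i < m) (A * B * q ^+ i)%:E)%E).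
  apply: lee_sum => i _; rewrite /h ge0_integralZl//; last 2 first.
  - by move=> t _; rewrite patchE; case: ifP => // _ /=; rewrite lee_fin.
  - by rewrite lee_fin.
  rewrite -integral_mkcondr.
  apply: (@le_trans _ _ ((c i)%:E * (A * rho i `^ N)%:E)%E).
    by apply: lee_wpmul2l; [rewrite lee_fin|exact: grow].
  rewrite -EFinM lee_fin mulrCA -mulrA ler_wpM2l//.
rewrite sumEFin lee_fin.
have := @geometric_le_lim R m (A * B) q (mulr_ge0 A0 B0) q0.
by rewrite ger0_norm ?(ltW q0)//; apply.
Unshelve. all: by end_near. Qed.

End cover.

Let dyadic_below (v : R) : 0 < v <= 1 ->
  exists i, 2^-1 ^+ i.+1 < v <= 2^-1 ^+ i.
Proof.
move=> /andP[v0 v1].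
have ex : exists i, 2^-1 ^+ i.+1 < v.
  have /cvgrPdist_lt/(_ _ v0)[m _ mP] := @cvg_geometric R 1 2^-1
    (ltac:(by rewrite ger0_norm ?invr_ge0// invf_lt1// ltr1n)).
  exists m; have := mP m.+1 (leqnSn m).
  rewrite /= sub0r normrN mul1r ger0_norm// exprn_ge0//.
case: (ex_minnP ex) => i iP imin; exists i; rewrite iP/=.
case: i iP imin => [_ _|i iP imin]; first by rewrite expr0.
by rewrite leNgt; apply/negP => /imin; rewrite ltnn.
Qed.

Let powR2i (N : R) i : (2^-1 ^+ i) `^ N = (2^-1 `^ N) ^+ i :> R.
Proof.
by rewrite -powR_mulrn ?invr_ge0// -powRrM mulrC powRrM powR_mulrn ?powR_ge0.
Qed.

Let powR2i1 (N : R) : 2^-1 `^ N = (2 `^ N)^-1 :> R.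
Proof. by rewrite -powR_inv1// -powRrM mulN1r powRN. Qed.

(** Annuli of radii [2^i]: the exponents on either side of [N] make both
    geometric series converge. *)
Lemma integral_bipower (a b N : R) : 0 <= a -> a < N -> N < b ->
  exists2 C : R, 0 <= C &
  forall d (T : measurableType d) (nu : {measure set T -> \bar R})
    (D : set T) (phi u : T -> R) (A : R),
  measurable D -> measurable_fun [set: T] phi -> measurable_fun [set: T] u ->
  (forall t, 0 <= phi t) -> (forall t, D t -> 0 < u t) -> 0 <= A ->
  (forall r, 0 < r ->
    (\int[nu]_(t in D `&` [set t | (u t < r)%R]) (phi t)%:E <=
     (A * r `^ N)%:E)%E) ->
  (\int[nu]_(t in D) (phi t * bipower a b (u t))%:E <= (A * C)%:E)%E.
Proof.
move=> a0 aN Nb.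
pose q1 : R := 2^-1 `^ (N - a); pose q2 : R := 2^-1 `^ (b - N).
have half01 : 0 < (2^-1 : R) < 1 by rewrite invr_gt0 ltr0n invf_lt1// ltr1n.
have qlt1 e : 0 < e -> 0 < (2^-1 : R) `^ e < 1.
  move=> e0; rewrite powR_gt0 ?invr_gt0//=.
  apply: (@lt_le_trans _ _ (1 `^ e)); last by rewrite powR1.
  by rewrite gt0_ltr_powR// ?nnegrE ?invr_ge0//; case/andP: half01.
have q1P : 0 < q1 < 1 by apply: qlt1; rewrite subr_gt0.
have q2P : 0 < q2 < 1 by apply: qlt1; rewrite subr_gt0.
pose C := 2 `^ a * 2 `^ N / (1 - q1) + 2 `^ N / (1 - q2).
exists C.
  case/andP: q1P => _ ?; case/andP: q2P => _ ?.
  by rewrite addr_ge0// divr_ge0 ?mulr_ge0 ?powR_ge0 ?subr_ge0 ?ltW.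
move=> d T nu D phi u A mD mphi mu phi0 u0 A0 grow.
have mle : measurable [set t | u t <= 1].
  rewrite -[X in measurable X]setTI (_ : [set t | _] = u @^-1` `]-oo, 1]).
    exact: mu.
  by apply/seteqP; split=> t /=; rewrite in_itv.
have mf : measurable_fun D (fun t => (phi t * bipower a b (u t))%:E).
  apply/measurable_EFinP; apply: measurable_funTS; apply: measurable_funM => //.
  exact: (measurableT_comp (measurable_bipower a b)).
have f0 t : (0 <= (phi t * bipower a b (u t))%:E)%E.
  by rewrite lee_fin mulr_ge0 ?bipower_ge0.
pose D1 := D `&` [set t | u t <= 1]; pose D2 := D `\` [set t | u t <= 1].
have mD1 : measurable D1 by exact: measurableI.
have mD2 : measurable D2 by exact: measurableD.
have DE : D = D1 `|` D2 by rewrite /D1 /D2 setUIDK.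
have msub r : measurable [set t | u t < r].
  exact: measurable_sublevel mu.
have growS D' : measurable D' -> D' `<=` D -> forall r, 0 < r ->
    (\int[nu]_(t in D' `&` [set t | (u t < r)%R]) (phi t)%:E <=
     (A * r `^ N)%:E)%E.
  move=> mD' D'D r r0; apply: le_trans (grow r r0).
  apply: ge0_subset_integral => //; try exact: measurableI.
  - by apply/measurable_EFinP; exact: measurable_funTS.
  - by move=> t _; rewrite lee_fin.
  - by apply: setSI.
rewrite [X in integral _ X]DE ge0_integral_setU//; last 2 first.
- by rewrite -DE.
- by rewrite disj_set2E; apply/eqP/seteqP; split=> // t [[_ ?] [_ ?]].
rewrite mulrDr EFinD; apply: leeD.
- have -> : (\int[nu]_(t in D1) (phi t * bipower a b (u t))%:E =
    \int[nu]_(t in D1) (phi t * (fun v => v `^ (- a)) (u t))%:E)%E.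
    by apply: eq_integral => t; rewrite inE => -[_ /= ut1]; rewrite /bipower ut1.
  apply: (@integral_sublevel_series _ _ nu D1 phi u mD1 mphi mu phi0 (fun v => v `^ (- a))
    (fun i => (2^-1 ^+ i.+1) `^ (- a)) (fun i => 2 * 2^-1 ^+ i) A (2 `^ a * 2 `^ N) q1 N) => //.
  + by move=> v; exact: powR_ge0.
  + move=> t [Dt /= ut1].
    have [|i /andP[i1 i2]] := @dyadic_below (u t); first by rewrite u0.
    exists i; first by apply: le_lt_trans i2 _; rewrite ltr_pMl ?ltr1n ?exprn_gt0 ?invr_gt0.
    rewrite !powRN lef_pV2 ?posrE ?powR_gt0 ?u0 ?exprn_gt0 ?invr_gt0//.
    by rewrite ge0_ler_powR// ?nnegrE ?exprn_ge0 ?invr_ge0// ?(ltW (u0 _ Dt)) ?ltW.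
  + exact: growS mD1 (@subIsetl _ _ _).
  + move=> i; rewrite powRM ?exprn_ge0 ?invr_ge0//.
    rewrite !powR2i powR2i1 powRN invrK exprSr.
    rewrite (_ : q1 = 2 `^ a * 2^-1 `^ N) ?exprMn; last first.
      by rewrite /q1 powRB ?powR2i1 ?invrK//; [rewrite mulrC|rewrite implybE invr_eq0 pnatr_eq0 orbT].
    by rewrite powR2i1 le_eqVlt; apply/orP; left; apply/eqP; ring.
- have -> : (\int[nu]_(t in D2) (phi t * bipower a b (u t))%:E =
    \int[nu]_(t in D2) (phi t * (fun v => v `^ (- b)) (u t))%:E)%E.
    by apply: eq_integral => t; rewrite inE => -[_ /= /negP/negbTE ut1]; rewrite /bipower ut1.
  have b0 : 0 <= b by rewrite ltW// (le_lt_trans a0)// (lt_trans aN).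
  apply: (@integral_sublevel_series _ _ nu D2 phi u mD2 mphi mu phi0 (fun v => v `^ (- b))
    (fun i => (2^-1 ^+ i) `^ b) (fun i => (2 * (2^-1 ^+ i)^-1)) A (2 `^ N) q2 N) => //.
  + by move=> v; exact: powR_ge0.
  + move=> t [Dt /= /negP]; rewrite -ltNge => ut1.
    have uV : 0 < (u t)^-1 <= 1.
      by rewrite invr_gt0 u0//= invf_le1 ?u0// ltW.
    have [i /andP[i1 i2]] := dyadic_below uV.
    exists i.
      move: i1; rewrite -[X in _ < X -> _]div1r ltr_pdivlMr ?u0// => i1.
      rewrite -(ltr_pM2l (x := 2^-1 ^+ i.+1)); last by rewrite exprn_gt0// invr_gt0.
      apply: (lt_le_trans i1); rewrite exprS mulrA [_ * 2]mulrC !mulrA mulfV// mul1r.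
      by rewrite mulfV// expf_neq0// invr_eq0.
    have -> : u t `^ (- b) = (u t)^-1 `^ b.
      by rewrite -powR_inv1 ?(ltW (u0 _ Dt))// -powRrM mulN1r.
    by rewrite ge0_ler_powR// ?nnegrE ?exprn_ge0 ?invr_ge0// ?(ltW (u0 _ Dt)) ?ltW.
  + exact: growS mD2 (@subDsetl _ _ _).
  + move=> i; rewrite powRM ?invr_ge0 ?exprn_ge0 ?invr_ge0//.
    have -> : ((2^-1 ^+ i)^-1) `^ N = ((2^-1 `^ N) ^+ i)^-1 :> R.
      by rewrite -powR_inv1 ?exprn_ge0 ?invr_ge0// -powRrM mulN1r powRN powR2i.
    rewrite powR2i (_ : q2 = 2^-1 `^ b / 2^-1 `^ N) ?expr_div_n.
      by rewrite le_eqVlt; apply/orP; left; apply/eqP; ring.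
    by rewrite /q2 powRB// implybE invr_eq0 pnatr_eq0 orbT.
Qed.

End dyadic.


(** * Pointwise bounds on the kernels *)

Section exponential_coordinates.
Context (R : realType).

(** Real powers of positive numbers are handled in logarithmic coordinates,
    where inequalities between monomials become linear. *)
Lemma powR_expR (z a : R) : expR z `^ a = expR (a * z).
Proof. by rewrite /powR gt_eqF ?expR_gt0// expRK. Qed.

Lemma bipower_expR (a b z : R) :
  bipower a b (expR z) = expR (- (if z <= 0 then a else b) * z).
Proof.
by rewrite /bipower -expR0 ler_expR; case: ifP => _; rewrite powR_expR.
Qed.

Lemma gt0_expR (x : R) : 0 < x -> exists z, x = expR z.
Proof. by move=> x0; exists (ln x); rewrite lnK. Qed.

(** The elementary substitute for Hoelder's inequality: it is used with a
    [delta] depending on the point of integration. *)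
Lemma le_add_powR (a delta p : R) : 0 <= a -> 0 < delta -> 1 <= p ->
  a <= delta + delta `^ (1 - p) * a `^ p.
Proof.
move=> a0 d0 p1.
have [ad|da] := leP a delta.
  by rewrite (le_trans ad)// lerDl mulr_ge0 ?powR_ge0.
apply: (@le_trans _ _ (delta `^ (1 - p) * a `^ p)); last by rewrite lerDr ltW.
have {}a0 : 0 < a by apply: lt_trans da.
move: da; have [z ->] := gt0_expR d0; have [w ->] := gt0_expR a0.
rewrite ltr_expR => zw.
by rewrite !powR_expR -expRD ler_expR; nra.
Qed.

End exponential_coordinates.

Section weights.
Context (R : realType).
Variables (m p alpha gamma b1 b3 : R).

(** The majorant of the theorem, as a function of [h = x_n] and [s = |x|]. *)
Definition majorant (h s : R) : R :=
  h `^ (1 - alpha / p) *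
  s `^ (gamma / p + (m - 1) * (1 - p^-1) - m + alpha / p).

Lemma majorant_gt0 h s : 0 < h -> 0 < s -> 0 < majorant h s.
Proof. by move=> h0 s0; rewrite mulr_gt0 ?powR_gt0. Qed.

Hypotheses (p1 : 1 <= p) (m0 : 0 <= m) (alpha0 : 0 <= alpha)
  (b3p : gamma + b3 * (p - 1) <= m * p).

Let p0 : p != 0. Proof. by rewrite gt_eqF// (lt_le_trans ltr01). Qed.

Let majorant_expR H S : exists2 G,
  majorant (expR H) (expR S) = expR G &
  p * G = (p - alpha) * H + (gamma + (m - 1) * (p - 1) - m * p + alpha) * S.
Proof.
rewrite /majorant !powR_expR -expRD; eexists; first by [].
by field.
Qed.

(** Away from [x] the kernel is at most [h d^(-m)], and the exponents [b1] and
    [b3] compensate for the weight [r^gamma] inside and outside the ball of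
    radius [s]. *)
Lemma weight_far tau h s d r : 0 < tau -> 0 < h -> h <= s -> 0 < r -> 0 < d ->
  s <= 5 * d -> r <= 5 * d ->
  (tau * majorant h s * s `^ (1 - m) * bipower b1 b3 (r / s)) `^ (1 - p) *
  (h `^ (1 - m) * bipower (m - 2) m (d / h)) `^ p * r `^ gamma <=
  5 `^ (m * p) * (tau `^ (1 - p) * majorant h s) *
  bipower (- (gamma + b1 * (p - 1))) 0 (r / s).
Proof.
move=> tau0 h0 hs r0 d0.
have s0 : 0 < s by apply: lt_le_trans hs.
have [T ->] := gt0_expR tau0; have [H hE] := gt0_expR h0.
have [S sE] := gt0_expR s0; have [r' ->] := gt0_expR r0.
have [d' ->] := gt0_expR d0; have [L ->] : exists L, 5 = expR L :> R.
  exact: gt0_expR.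
move: hs; rewrite hE sE ler_expR -!expRD !ler_expR => HS Sd rd.
have [G -> pG] := majorant_expR H S.
rewrite -!expRB !powR_expR !bipower_expR -!expRD !powR_expR -!expRD ler_expR.
have dH : - (if d' - H <= 0 then m - 2 else m) * (d' - H) <= - m * (d' - H).
  by case: ifP => // dH; nra.
have pdH := ler_wpM2l (le_trans ler01 p1) dH.
have pmL : 0 <= m * p by rewrite mulr_ge0// (le_trans ler01 p1).
have aHS : alpha * H <= alpha * S by rewrite ler_wpM2l.
move: (if d' - H <= 0 then _ else _) pdH {dH} => k pdH.
have [w0|w0] := leP (r' - S) 0.
  have e := ler_wpM2l pmL Sd.
  by lra.
have e := ler_wpM2l pmL rd.
have e' : (gamma + b3 * (p - 1)) * (r' - S) <= m * p * (r' - S).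
  by rewrite ler_wpM2r// ltW.
by lra.
Qed.

(** Near [x] the auxiliary weights are bounded, and only the [p]-th power of
    the kernel remains. *)
Lemma weight_near tau h s d r : 0 < tau -> 0 < h -> 0 < s -> 0 < r -> 0 < d ->
  r <= 3 * s -> s <= 3 * r ->
  (tau * majorant h s * s `^ (1 - m) * bipower b1 b3 (r / s)) `^ (1 - p) *
  (h `^ (1 - m) * bipower (m - 2) m (d / h)) `^ p * r `^ gamma <=
  3 `^ (`|gamma + b1 * (p - 1)| + `|gamma + b3 * (p - 1)|) *
  (tau `^ (1 - p) * majorant h s) * ((s / h) `^ (p * m - alpha) *
  bipower ((m - 2) * p) (m * p) (d / h)).
Proof.
move=> tau0 h0 s0 r0 d0.
have [T ->] := gt0_expR tau0; have [H ->] := gt0_expR h0.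
have [S ->] := gt0_expR s0; have [r' ->] := gt0_expR r0.
have [d' ->] := gt0_expR d0; have [L E3] : exists L, 3 = expR L :> R.
  exact: gt0_expR.
rewrite !E3 -!expRD !ler_expR => rS Sr.
have L0 : 0 <= L by rewrite -ler_expR expR0 -E3 ler1n.
have [G -> pG] := majorant_expR H S.
rewrite -!expRB !powR_expR !bipower_expR -!expRD !powR_expR -!expRD ler_expR.
have key c : c * (r' - S) <= `|c| * L.
  apply: (le_trans (ler_norm _)); rewrite normrM ler_wpM2l//.
  by rewrite ler_norml; apply/andP; split; lra.
have k1 := key (gamma + b1 * (p - 1)).
have k3 := key (gamma + b3 * (p - 1)).
have := mulr_ge0 (normr_ge0 (gamma + b1 * (p - 1))) L0.
have := mulr_ge0 (normr_ge0 (gamma + b3 * (p - 1))) L0.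
set c1 := `|_|%R; set c3 := `|_|%R; move: (k1) (k3); rewrite -/c1 -/c3.
by case: (d' - H <= 0); case: (r' - S <= 0); lra.
Qed.

End weights.


Section kernels.
Context (R : realType) (n : nat).
Implicit Types x y : point R n.

(** [x_n |x-y|^(2-n) / max(x_n, |x-y|)^2], written with the profile [bipower]:
    up to constants it is the Poisson kernel when [y] is on the boundary, and
    the Green function divided by [- y_n] when [y] is inside. *)
Definition halfspace_kernel x y : R :=
  x.2 `^ (1 - n%:R) * bipower (n%:R - 2) n%:R (dist x y / x.2).

Lemma halfspace_kernel_ge0 x y : 0 <= halfspace_kernel x y.
Proof. by rewrite mulr_ge0 ?powR_ge0 ?bipower_ge0. Qed.

Lemma measurable_halfspace_kernel x : measurable_fun [set: point R n] (halfspace_kernel x).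
Proof.
apply: measurable_funM => //.
apply: (measurableT_comp (measurable_bipower _ _)).
by apply: measurable_funM => //; exact: measurable_dist.
Qed.

Lemma poisson_kernel x (y' : bdry R n) : 0 < x.2 ->
  poisson x y' = 2 / omega R n * halfspace_kernel x (y', 0).
Proof.
move=> x0; rewrite /poisson /halfspace_kernel -/(dist x (y', 0)).
have xd : x.2 <= dist x (y', 0).
  have := height_le_dist x ((y', 0) : point R n).
  by rewrite /= subr0 ger0_norm// ltW.
have d0 : 0 < dist x (y', 0) by apply: lt_le_trans xd.
have -> : bipower (n%:R - 2) n%:R (dist x (y', 0) / x.2) =
    (dist x (y', 0) / x.2) `^ (- n%:R).
  rewrite /bipower; case: ifP => //; rewrite ler_pdivrMr// mul1r => dx.
  have -> : dist x (y', 0) = x.2 by apply/eqP; rewrite eq_le dx.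
  by rewrite divff ?gt_eqF// !powR1.
rewrite powRM ?invr_ge0 ?ltW//.
have -> : x.2^-1 `^ (- n%:R) = x.2 `^ n%:R.
  by rewrite -powR_inv1 ?ltW// -powRrM mulN1r opprK.
have -> : x.2 `^ (1 - n%:R) = x.2 / x.2 ^+ n.
  rewrite powRB; last by rewrite (gt_eqF x0) implybT.
  by rewrite powRr1 ?ltW// powR_mulrn ?ltW.
rewrite powRN !powR_mulrn ?ltW// invfM.
have xn : x.2 ^+ n != 0 by rewrite expf_neq0// gt_eqF.
have dn : dist x (y', 0) ^+ n != 0 by rewrite expf_neq0// gt_eqF.
by rewrite [RHS](_ : _ = 2 * x.2 / omega R n / dist x (y', 0) ^+ n
  * (x.2 ^+ n / x.2 ^+ n)); [rewrite mulfV// mulr1; ring|ring].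
Qed.

Let one_sub_powR (t a : R) : 0 < t -> t <= 1 -> 1 <= a ->
  1 - t `^ a <= a * (1 - t ^+ 2).
Proof.
move=> t0 t1 a1.
have h : 1 - t `^ a <= a * (1 - t).
  have [z tz] := gt0_expR t0; rewrite tz powR_expR.
  have z0 : z <= 0 by rewrite -ler_expR -tz expR0.
  have := @expR_ge1Dx R z; have := @expR_ge1Dx R ((a - 1) * z).
  have -> : a * z = z + (a - 1) * z by ring.
  rewrite expRD => h1 h2; have e0 := expR_gt0 z.
  have : expR z * (1 + (a - 1) * z) <= expR z * expR ((a - 1) * z).
    by rewrite ler_wpM2l// ltW.
  have e2 : expR z * (- z) <= 1 - expR z.
    have := @expR_ge1Dx R (- z).
    rewrite -(ler_pM2l e0) mulrDr -expRD subrr expR0 mulr1; lra.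
  by have := @ler_wpM2l _ (a - 1) _ _ _ e2; rewrite subr_ge0 => /(_ a1); lra.
apply: (le_trans h); rewrite ler_wpM2l ?(le_trans ler01)// lerD2l lerN2.
by rewrite expr2 ger_pMl.
Qed.

(** Since [|x - y*|^2 - |x - y|^2 = 4 x_n y_n], the two terms of the Green
    function almost cancel where [y] is far from [x]. *)
Lemma green_le_kernel x y : (3 <= n)%N -> 0 < x.2 -> 0 < y.2 -> x != y ->
  (`|green x y| <= (4 * (n%:R - 2) * `|rconst R n| * (halfspace_kernel x y * y.2))%:E)%E.
Proof.
move=> n3 x0 y0 xy; rewrite /green (negbTE xy) /= lee_fin /fundamental /halfspace_kernel.
have n3' : 3 <= n%:R :> R by rewrite ler_nat.
rewrite -/(dist x y) -/(dist x (reflection y)).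
have d0 : 0 < dist x y.
  rewrite lt_def dist_ge0 andbT; apply: contra xy => /eqP d0.
  exact/eqP/dist_eq0.
have e0 := dist_ge0 x (reflection y); have eE := dist_reflection x y.
move: (dist x y) (dist x (reflection y)) d0 e0 eE (@height_le_dist _ _ x (reflection y)) => d e d0 e0 eE /= xye.
have xe : x.2 <= e.
  apply: le_trans xye; rewrite opprK ger0_norm ?lerDl ?ltW// addr_gt0//.
have de : d <= e.
  by rewrite -(@ler_pXn2r _ 2)// ?nnegrE ?(ltW d0)// eE lerDl !mulr_ge0// ltW.
have {}e0 : 0 < e by apply: lt_le_trans xe.
rewrite -mulrBr normrM normrN.
rewrite [leRHS](_ : _ = `|rconst R n| *
  (4 * (n%:R - 2) * (x.2 `^ (1 - n%:R) * bipower (n%:R - 2) n%:R (d / x.2) * y.2))); last by ring.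
rewrite ler_wpM2l//.
have a1 : 1 <= n%:R - 2 :> R by lra.
have te : d / e <= 1 by rewrite ler_pdivrMr// mul1r.
have t0 : 0 < d / e by rewrite divr_gt0.
have one := one_sub_powR t0 te a1.
have diff : d `^ (2 - n%:R) - e `^ (2 - n%:R) =
    d `^ (2 - n%:R) * (1 - (d / e) `^ (n%:R - 2)).
  have [D ->] := gt0_expR d0; have [E ->] := gt0_expR e0.
  rewrite -expRB !powR_expR mulrBr mulr1 -expRD; congr (_ - expR _); ring.
have tt : 1 - (d / e) ^+ 2 = 4 * x.2 * y.2 / e ^+ 2.
  have dd : d ^+ 2 = e ^+ 2 - 4 * x.2 * y.2 by rewrite eE addrK.
  by rewrite expr_div_n dd; field; rewrite gt_eqF.
have shape : d `^ (2 - n%:R) * (x.2 / e ^+ 2) <=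
    x.2 `^ (1 - n%:R) * bipower (n%:R - 2) n%:R (d / x.2).
  move: xe de; have [D ->] := gt0_expR d0; have [E ->] := gt0_expR e0.
  have [X ->] := gt0_expR x0; rewrite !ler_expR => XE DE.
  rewrite -expRB -expRM_natl -expRB !powR_expR bipower_expR -!expRD ler_expR.
  by case: ifP => DX; nra.
rewrite diff ger0_norm; last first.
  rewrite mulr_ge0 ?powR_ge0// subr_ge0.
  apply: (@le_trans _ _ (1 `^ (n%:R - 2))); last by rewrite powR1.
  by rewrite ge0_ler_powR ?nnegrE ?(ltW t0)//; lra.
apply: (@le_trans _ _ (d `^ (2 - n%:R) * ((n%:R - 2) * (4 * x.2 * y.2 / e ^+ 2)))).
  by rewrite ler_wpM2l ?powR_ge0// -tt.
rewrite [leLHS](_ : _ = 4 * (n%:R - 2) * (d `^ (2 - n%:R) * (x.2 / e ^+ 2) * y.2)); last by ring.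
rewrite ler_wpM2l//; first by lra.
by rewrite ler_wpM2r// ltW.
Qed.

End kernels.


(** * The growth estimate *)

Section tails.
Context d (T : measurableType d) (R : realType) (nu : {measure set T -> \bar R}).
Variables (D : set T) (phi r : T -> R).
Hypotheses (mD : measurable D) (mphi : measurable_fun [set: T] phi)
  (mr : measurable_fun [set: T] r) (phi0 : forall t, 0 <= phi t)
  (r0 : forall t, 0 < r t)
  (phioo : (\int[nu]_(t in D) (phi t)%:E < +oo)%E).

Let mE E : measurable_fun E (EFin \o phi).
Proof. by apply: measurable_funTS; exact/measurable_EFinP. Qed.

Let msub M : measurable [set t | r t < M] := measurable_sublevel M mr.

Lemma integral_tail e : 0 < e -> exists2 M, 0 < M &
  (\int[nu]_(t in D `\` [set t | (r t < M)%R]) (phi t)%:E <= e%:E)%E.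
Proof.
move=> e0; pose E k := D `&` [set t | r t < k%:R].
have mEk k : measurable (E k) by exact: measurableI.
have UE : \bigcup_k E k = D.
  apply/seteqP; split=> [t [k _ []]//|t Dt].
  exists (Num.trunc (r t)).+1 => //; split=> //=.
  exact: truncnS_gt.
have ndE : nondecreasing_seq E.
  move=> i j ij; apply/subsetPset => t [Dt /= ri]; split=> //=.
  by apply: lt_le_trans ri _; rewrite ler_nat.
have ph0 (i : nat) t : E i t -> (0 <= (EFin \o phi) t)%E by rewrite /= lee_fin.
have := @ge0_nondecreasing_set_cvg_integral _ _ _ E (EFin \o phi) nu ndE mEk
  (fun k => @mE (E k)) ph0.
rewrite UE.
have I0 : (0 <= \int[nu]_(t in D) (phi t)%:E)%E.
  by apply: integral_ge0 => t _; rewrite lee_fin.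
have fin : (\int[nu]_(t in D) (phi t)%:E)%E \is a fin_num by rewrite ge0_fin_numE.
rewrite /= -(fineK fin) => /fine_cvgP[_ /cvgrPdist_lt /(_ _ e0)[k _ kP]].
exists k.+1%:R => //.
have := kP k.+1 (leqnSn k); rewrite /=.
have Ek0 : (0 <= \int[nu]_(t in E k.+1) (phi t)%:E)%E.
  by apply: integral_ge0 => t _; rewrite lee_fin.
have split_ : (\int[nu]_(t in D) (phi t)%:E = \int[nu]_(t in E k.+1) (phi t)%:E +
   \int[nu]_(t in D `\` [set t | (r t < k.+1%:R)%R]) (phi t)%:E)%E.
  rewrite -ge0_integral_setU//; last 3 first.
  - exact: measurableD.
  - by move=> t _; rewrite lee_fin.
  - by rewrite disj_set2E; apply/eqP/seteqP; split=> // t [[_ ?] [_ ?]].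
  by rewrite /E setUIDK.
have tail0 : (0 <= \int[nu]_(t in D `\` [set t | (r t < k.+1%:R)%R]) (phi t)%:E)%E.
  by apply: integral_ge0 => t _; rewrite lee_fin.
move: fin; rewrite split_ fin_numD => /andP[f1 f2].
by rewrite fineD// addrAC subrr add0r -{2}(fineK f2) lee_fin => /(le_lt_trans (ler_norm _))/ltW.
Qed.

(** The points at bounded distance have a weight which tends to zero, and those
    far away carry little of the integral of [phi]. *)
Lemma integral_decay c e : 0 < c -> 0 < e -> exists2 M, 0 < M &
  forall s, M <= s ->
  (\int[nu]_(t in D) (phi t * bipower (- c) 0 (r t / s))%:E <= e%:E)%E.
Proof.
move=> c0 e0; have e20 : 0 < e / 2 by rewrite divr_gt0.
have [M M0 tailM] := integral_tail e20.
have I0 : (0 <= \int[nu]_(t in D) (phi t)%:E)%E.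
  by apply: integral_ge0 => t _; rewrite lee_fin.
have fin : (\int[nu]_(t in D) (phi t)%:E)%E \is a fin_num by rewrite ge0_fin_numE.
pose I := fine (\int[nu]_(t in D) (phi t)%:E)%E.
have I0' : 0 <= I by rewrite fine_ge0.
pose eta := e / 2 / (I + 1).
have eta0 : 0 < eta by rewrite divr_gt0// ltr_wpDl.
(* so that [(M / s) ^ c <= eta] beyond [S] *)
pose S := M * eta `^ (- c^-1) + M.
exists S => [|s Ss]; first by rewrite ltr_wpDl// mulr_ge0 ?powR_ge0// ltW.
have Ms : M <= s by apply: le_trans Ss; rewrite lerDr mulr_ge0 ?powR_ge0// ltW.
have s0 : 0 < s by apply: lt_le_trans Ms.
have MS : (M / s) `^ c <= eta.
  have Ms' : M / s <= eta `^ c^-1.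
    rewrite ler_pdivrMr// mulrC -ler_pdivrMr ?powR_gt0// -powRN.
    by apply: le_trans Ss; rewrite lerDl ltW.
  have -> : eta = (eta `^ c^-1) `^ c by rewrite -powRrM mulVf ?gt_eqF// powRr1// ltW.
  by rewrite ge0_ler_powR// ?nnegrE ?powR_ge0 ?divr_ge0 ?(ltW c0)// ltW.
have bip1 t : bipower (- c) 0 (r t / s) <= 1.
  rewrite /bipower; case: ifP => [le1|_]; last by rewrite oppr0 powRr0.
  rewrite opprK; apply: (@le_trans _ _ (1 `^ c)); last by rewrite powR1.
  by rewrite ge0_ler_powR// ?nnegrE ?(ltW c0)// divr_ge0// ltW.
have mf : measurable_fun [set: T] (fun t => phi t * bipower (- c) 0 (r t / s)).
  apply: measurable_funM => //.
  apply: (measurableT_comp (measurable_bipower _ _)).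
  exact: measurable_funM.
have f0 t : 0 <= phi t * bipower (- c) 0 (r t / s) by rewrite mulr_ge0 ?bipower_ge0.
rewrite -(setUIDK D [set t | r t < M]) ge0_integral_setU//; last 5 first.
- exact: measurableI.
- exact: measurableD.
- by apply: measurable_funTS; exact/measurable_EFinP.
- by move=> t _; rewrite lee_fin.
- by rewrite disj_set2E; apply/eqP/seteqP; split=> // t [[_ ?] [_ ?]].
have -> : e = e / 2 + e / 2 by rewrite -splitr.
rewrite EFinD; apply: leeD; last first.
  apply: le_trans tailM; apply: ge0_le_integral => //.
  - exact: measurableD.
  - by move=> t _; rewrite lee_fin.
  - by apply: measurable_funTS; exact/measurable_EFinP.
  - by move=> t _; rewrite lee_fin ler_piMr.
apply: (@le_trans _ _ (\int[nu]_(t in D `&` [set t | (r t < M)%R]) (eta%:E * (phi t)%:E))%E).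
  apply: ge0_le_integral => //.
  - exact: measurableI.
  - by move=> t _; rewrite lee_fin.
  - by apply: measurable_funTS; exact/measurable_EFinP.
  - by apply: measurable_funeM; exact: mE.
  - move=> t [_ /= rM]; rewrite -EFinM lee_fin mulrC ler_wpM2r//.
    apply: le_trans MS; rewrite /bipower ifT; last first.
      by rewrite ler_pdivrMr// mul1r (le_trans _ Ms)// ltW.
    rewrite opprK ge0_ler_powR// ?nnegrE ?(ltW c0)// ?divr_ge0 ?(ltW (r0 t))// ?ltW//.
    by rewrite ltr_pM2r// invr_gt0.
rewrite ge0_integralZl_EFin//; last 3 first.
- exact: measurableI.
- by move=> t _; rewrite lee_fin.
- exact: ltW.
apply: (@le_trans _ _ (eta%:E * I%:E)%E).
  rewrite lee_pmul2l// ?lte_fin// /I fineK//.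
  apply: ge0_subset_integral => //; first exact: measurableI.
  by move=> t _; rewrite lee_fin.
by rewrite -EFinM lee_fin /eta mulrAC ler_pdivrMr ?ltr_wpDl// ler_wpM2l ?lerDl// ltW.
Qed.

End tails.


Section estimate.
Context (R : realType) (n : nat) (p alpha gamma : R).
Hypotheses (n3 : (3 <= n)%N) (p1 : 1 <= p) (alpha02 : 0 < alpha < 2)
  (gamma_p : 1 < p -> - ((n%:R - 1) * (p - 1)) < gamma < n%:R - 1 + p)
  (gamma_1 : p = 1 -> 0 < gamma <= n%:R).

(** Exponents of the weight in [delta] below: with [b1 < n - 1 < b3] it is
    integrable against a measure of growth [r^(n-1)], and the last two
    conditions are those under which [weight_far] gives a bounded and, inside,
    a decaying weight. The hypothesis on [gamma] is exactly what leaves room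
    for them. *)
Lemma weight_exponents : exists b1 b3 : R,
  [/\ 0 <= b1, b1 < n%:R - 1, n%:R - 1 < b3, 0 < gamma + b1 * (p - 1) &
      gamma + b3 * (p - 1) <= n%:R * p].
Proof.
have n3' : 3 <= n%:R :> R by rewrite ler_nat.
move: p1; rewrite le_eqVlt => /predU1P[/esym p1'|p1'].
  have /andP[g0 gn] := gamma_1 p1'.
  exists 0, n%:R; rewrite p1' subrr !mulr0 !addr0 mulr1; split=> //; lra.
have /andP[gl gu] := gamma_p p1'.
have q0 : 0 < p - 1 by rewrite subr_gt0.
have gq : - gamma / (p - 1) < n%:R - 1 by rewrite ltr_pdivrMr//; lra.
pose b0 := Num.max 0 (- gamma / (p - 1)).
have b0n : b0 < n%:R - 1 by rewrite gt_max gq andbT; lra.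
exists ((b0 + (n%:R - 1)) / 2), ((n%:R * p - gamma) / (p - 1)).
have b00 : 0 <= b0 by rewrite le_max lexx.
have b0g : - gamma / (p - 1) <= b0 by rewrite le_max lexx orbT.
split.
- by rewrite divr_ge0//; lra.
- by lra.
- by rewrite ltr_pdivlMr//; lra.
- have : - gamma / (p - 1) < (b0 + (n%:R - 1)) / 2 by lra.
  by rewrite ltr_pdivrMr//; lra.
- by rewrite divfK ?gt_eqF//; lra.
Qed.

Context d (T : measurableType d) (nu : {measure set T -> \bar R}) (D : set T)
  (pr : T -> point R n) (F : T -> R) (A : R).

Definition energy t : R := F t `^ p / (1 + enorm (pr t)) `^ gamma.

Hypotheses (mD : measurable D) (mpr : measurable_fun [set: T] pr)
  (mF : measurable_fun [set: T] F) (F0 : forall t, D t -> 0 <= F t)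
  (A0 : 0 <= A).

Lemma energy_ge0 t : 0 <= energy t.
Proof. by rewrite divr_ge0 ?powR_ge0. Qed.

Let mr : measurable_fun [set: T] (fun t => 1 + enorm (pr t)).
Proof.
apply: measurable_funD => //.
exact: (measurableT_comp (@measurable_enorm R n)).
Qed.

Let r0 t : 0 < 1 + enorm (pr t).
Proof. by rewrite ltr_pwDl// enorm_ge0. Qed.

Lemma measurable_energy : measurable_fun [set: T] energy.
Proof.
apply: measurable_funM.
  exact: (measurableT_comp (measurable_powR p)).
rewrite (_ : (fun t => _) = fun t => (1 + enorm (pr t)) `^ (- gamma)).
  exact: (measurableT_comp (measurable_powR (- gamma))).
by apply/funext => t; rewrite powRN.
Qed.

Hypothesis energyoo : (\int[nu]_(t in D) (energy t)%:E < +oo)%E.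
Hypothesis growth : forall r, 0 < r ->
  (nu (D `&` [set t | (1 + enorm (pr t) < r)%R]) <= (A * r `^ (n%:R - 1))%:E)%E.

Let n3' : 3 <= n%:R :> R. Proof. by rewrite ler_nat. Qed.

Let p0 : 0 < p. Proof. exact: lt_le_trans ltr01 p1. Qed.

Section pointwise.
Variables (b1 b3 tau : R) (x : point R n).
Hypotheses (tau0 : 0 < tau) (x0 : 0 < x.2) (x1 : 1 <= enorm x)
  (b3p : gamma + b3 * (p - 1) <= n%:R * p).

Let s := enorm x.
Let g := majorant n%:R p alpha gamma x.2 s.
Let near_ball := [set t | 0 < dist x (pr t) < s / 2].

Let s0 : 0 < s. Proof. exact: lt_le_trans ltr01 x1. Qed.

Let delta t := tau * g * s `^ (1 - n%:R) * bipower b1 b3 ((1 + enorm (pr t)) / s).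

Let C1 := 5 `^ (n%:R * p) * (tau `^ (1 - p) * g).
Let C2 := 3 `^ (`|gamma + b1 * (p - 1)| + `|gamma + b3 * (p - 1)|) *
  (tau `^ (1 - p) * g).

Let xs : x.2 <= s.
Proof. by have := height_le_enorm x; rewrite ger0_norm// ltW. Qed.

Let g0 : 0 < g. Proof. exact: majorant_gt0. Qed.

Let energyE t : D t -> F t `^ p = energy t * (1 + enorm (pr t)) `^ gamma.
Proof. by rewrite /energy divfK// gt_eqF// powR_gt0. Qed.

(** The inequality [le_add_powR], applied with a [delta] whose total mass is at
    most a multiple of [tau * g] by the growth of [nu]; the two other terms are
    integrated against the energy. *)
Lemma kernel_pointwise t : D t ->
  halfspace_kernel x (pr t) * F t <= delta t +
    (C1 * (energy t * bipower (- (gamma + b1 * (p - 1))) 0 ((1 + enorm (pr t)) / s)) +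
     C2 * (s / x.2) `^ (p * n%:R - alpha) *
       (if t \in near_ball then energy t *
          bipower ((n%:R - 2) * p) (n%:R * p) (dist x (pr t) / x.2) else 0)).
Proof.
move=> Dt; have K0 := halfspace_kernel_ge0 x (pr t).
have del0 : 0 < delta t.
  rewrite /delta !mulr_gt0 ?powR_gt0// /bipower; case: ifP => _;
  by rewrite powR_gt0// divr_gt0.
apply: (le_trans (le_add_powR (mulr_ge0 K0 (F0 Dt)) del0 p1)).
rewrite lerD2l (powRM _ K0 (F0 Dt)) (energyE Dt).
have e0 := energy_ge0 t.
have C10 : 0 <= C1 by rewrite !mulr_ge0 ?powR_ge0// ltW.
have C20 : 0 <= C2 by rewrite !mulr_ge0 ?powR_ge0// ltW.
(* the real-valued kernel vanishes at the pole, because [0 `^ a = 0] *)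
have [d0|d0] := eqVneq (dist x (pr t)) 0.
  have -> : halfspace_kernel x (pr t) = 0.
    rewrite /halfspace_kernel d0 mul0r /bipower ler01 powR0 ?mulr0// oppr_eq0.
    by rewrite gt_eqF//; have := n3'; lra.
  rewrite powR0 ?gt_eqF// mul0r mulr0.
  apply: addr_ge0; first exact: mulr_ge0 C10 (mulr_ge0 e0 (bipower_ge0 _ _ _)).
  apply: mulr_ge0; first exact: mulr_ge0 C20 (powR_ge0 _ _).
  by case: ifP => // _; exact: mulr_ge0 e0 (bipower_ge0 _ _ _).
have {}d0 : 0 < dist x (pr t) by rewrite lt_def d0 dist_ge0.
have xd := enorm_le_dist x (pr t); have yd := enorm_le_dist (pr t) x.
rewrite dist_sym in yd; rewrite -/s in xd yd.
have y0 := enorm_ge0 (pr t).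
have regroup (a b c k : R) : a * (b * (c * k)) = a * b * k * c by ring.
rewrite regroup.
have [dn|df] := ltP (dist x (pr t)) (s / 2).
  have tn : t \in near_ball by rewrite inE /near_ball /= d0.
  rewrite tn.
  apply: (@le_trans _ _ (C2 * (s / x.2) `^ (p * n%:R - alpha) * (energy t *
      bipower ((n%:R - 2) * p) (n%:R * p) (dist x (pr t) / x.2)))); last first.
    by rewrite lerDr; exact: mulr_ge0 C10 (mulr_ge0 e0 (bipower_ge0 _ _ _)).
  rewrite [leRHS](_ : _ = C2 * ((s / x.2) `^ (p * n%:R - alpha) *
    bipower ((n%:R - 2) * p) (n%:R * p) (dist x (pr t) / x.2)) * energy t); last by ring.
  rewrite ler_wpM2r//.
  have x1' := x1; rewrite -/s in x1'.
  by apply: weight_near => //; lra.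
apply: (@le_trans _ _ (C1 * (energy t *
    bipower (- (gamma + b1 * (p - 1))) 0 ((1 + enorm (pr t)) / s)))); last first.
  rewrite lerDl; apply: mulr_ge0; first exact: mulr_ge0 C20 (powR_ge0 _ _).
  by case: ifP => // _; exact: mulr_ge0 e0 (bipower_ge0 _ _ _).
rewrite [leRHS](_ : _ = C1 * bipower (- (gamma + b1 * (p - 1))) 0
  ((1 + enorm (pr t)) / s) * energy t); last by ring.
rewrite ler_wpM2r//.
have x1' := x1; rewrite -/s in x1'.
by apply: weight_far => //; case/andP: alpha02 => *; lra.
Qed.

End pointwise.

(** The three terms of [kernel_pointwise] are integrated by means of the growth
    of [nu], of [integral_decay], and of a dyadic summation over the balls
    around [x], whose energies are controlled by the last hypothesis. *)
Lemma potential_estimate eps : 0 < eps -> exists2 e', 0 < e' & exists2 M, 0 < M &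
  forall x : point R n, 0 < x.2 -> M <= enorm x ->
  (forall r, 0 < r -> r <= enorm x / 2 ->
     (\int[nu]_(t in D `&` [set t | (dist x (pr t) < r)%R]) (energy t)%:E <=
      (e' * (r / enorm x) `^ (p * n%:R - alpha))%:E)%E) ->
  (\int[nu]_(t in D) (halfspace_kernel x (pr t) * F t)%:E <=
   (eps * majorant n%:R p alpha gamma x.2 (enorm x))%:E)%E.
Proof.
move=> eps0; have [b1 [b3 [b10 b1n nb3 c0 b3p]]] := weight_exponents.
have /andP[al0 al2] := alpha02.
have [C0 C00 C0P] := integral_bipower b10 b1n nb3.
have [a0 aN Nb] : [/\ 0 <= (n%:R - 2) * p, (n%:R - 2) * p < p * n%:R - alpha &
    p * n%:R - alpha < n%:R * p].
  by have := n3'; have := p1; have := p0; split; nra.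
have [C3 C30 C3P] := integral_bipower a0 aN Nb.
(* [tau] makes the mass of [delta] small; the constants [M] and [e'], which
   control the two energy terms, may then depend on [tau] *)
pose tau := eps / 3 / (A * C0 + 1).
have tau0 : 0 < tau by rewrite !divr_gt0// ltr_wpDl// mulr_ge0.
pose k1 := 5 `^ (n%:R * p) * tau `^ (1 - p).
have k10 : 0 < k1 by rewrite mulr_gt0 ?powR_gt0.
pose k2 := 3 `^ (`|gamma + b1 * (p - 1)| + `|gamma + b3 * (p - 1)|) * tau `^ (1 - p).
have k20 : 0 < k2 by rewrite mulr_gt0 ?powR_gt0.
have e10 : 0 < eps / 3 / k1 by rewrite !divr_gt0.
have [M1 M10 M1P] := integral_decay mD measurable_energy mr energy_ge0 r0 energyoo c0 e10.
pose e' := eps / 3 / (k2 * (C3 + 1)).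
have e'0 : 0 < e' by rewrite !divr_gt0// mulr_gt0// ltr_wpDl.
exists e' => //; exists (M1 + 1) => [|x x0 Mx sparse]; first by rewrite addr_gt0.
have x1 : 1 <= enorm x by apply: le_trans Mx; rewrite lerDr ltW.
have Mx1 : M1 <= enorm x by apply: le_trans Mx; rewrite lerDl.
set s := enorm x in x1 Mx1 sparse *.
set g := majorant _ _ _ _ _ _.
have s0 : 0 < s by apply: lt_le_trans x1.
have g0 : 0 < g by exact: majorant_gt0.
pose nb := [set t | 0 < dist x (pr t) < s / 2].
have md : measurable_fun [set: T] (fun t => dist x (pr t)).
  exact: (measurableT_comp (@measurable_dist R n x)).
have mnb : measurable nb.
  rewrite -[X in measurable X]setTI (_ : nb = (fun t => dist x (pr t)) @^-1` `]0, s / 2[).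
    exact: md.
  by apply/seteqP; split=> t /=; rewrite in_itv.
pose delta t := tau * g * s `^ (1 - n%:R) * bipower b1 b3 ((1 + enorm (pr t)) / s).
pose f1 t := energy t * bipower (- (gamma + b1 * (p - 1))) 0 ((1 + enorm (pr t)) / s).
pose f2 t := energy t * bipower ((n%:R - 2) * p) (n%:R * p) (dist x (pr t) / x.2).
have mbip a b u : measurable_fun [set: T] u -> measurable_fun [set: T] (fun t => bipower a b (u t)).
  by move=> mu; exact: (measurableT_comp (measurable_bipower a b)).
have mf1 : measurable_fun [set: T] f1.
  apply: measurable_funM; first exact: measurable_energy.
  by apply: mbip; exact: measurable_funM.
have mf2 : measurable_fun [set: T] f2.
  apply: measurable_funM; first exact: measurable_energy.
  by apply: mbip; exact: measurable_funM.
have f10 t : 0 <= f1 t by rewrite mulr_ge0 ?energy_ge0 ?bipower_ge0.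
have f20 t : 0 <= f2 t by rewrite mulr_ge0 ?energy_ge0 ?bipower_ge0.
have mdelta : measurable_fun [set: T] delta.
  by apply: measurable_funM => //; apply: mbip; exact: measurable_funM.
have cd0 : 0 <= tau * g * s `^ (1 - n%:R).
  exact: mulr_ge0 (ltW (mulr_gt0 tau0 g0)) (powR_ge0 _ _).
have delta0 t : 0 <= delta t by exact: mulr_ge0 cd0 (bipower_ge0 _ _ _).
pose c1 := k1 * g; pose c2 := k2 * g * (s / x.2) `^ (p * n%:R - alpha).
have c10 : 0 <= c1 by exact: ltW (mulr_gt0 k10 g0).
have c20 : 0 <= c2 by exact: mulr_ge0 (ltW (mulr_gt0 k20 g0)) (powR_ge0 _ _).
have mpatch : measurable_fun D ((EFin \o f2) \_ nb).
  apply: measurable_funTS; apply/(measurable_restrictT _ _).1 => //.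
  by apply: measurable_funTS; exact/measurable_EFinP.
have patch0 t : (0 <= ((EFin \o f2) \_ nb) t)%E.
  by rewrite patchE; case: ifP => // _; rewrite /= lee_fin.
have mEF (f : T -> R) : measurable_fun [set: T] f -> measurable_fun D (EFin \o f).
  by move=> mf; apply: measurable_funTS; exact/measurable_EFinP.
apply: (@le_trans _ _ (\int[nu]_(t in D) ((delta t)%:E +
   (c1%:E * (f1 t)%:E + c2%:E * ((EFin \o f2) \_ nb) t)))%E).
  apply: ge0_le_integral => //.
  - by move=> t Dt; rewrite lee_fin mulr_ge0 ?halfspace_kernel_ge0 ?F0.
  - apply: mEF; apply: measurable_funM => //.
    exact: (measurableT_comp (@measurable_halfspace_kernel R n x)).
  - apply: emeasurable_funD; first exact: mEF.
    by apply: emeasurable_funD; apply: measurable_funeM => //; exact: mEF.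
  - move=> t Dt; have := @kernel_pointwise b1 b3 tau x tau0 x0 x1 b3p t Dt.
    rewrite -/s -/g -lee_fin => /le_trans; apply.
    rewrite EFinD leeD2l// EFinD; apply: leeD.
      by rewrite -EFinM lee_fin /c1 /k1 (mulrA _ (tau `^ (1 - p)) g).
    rewrite patchE -/nb; case: ifP => _; last by rewrite mulr0 mule0.
    by rewrite -EFinM lee_fin /c2 /k2 (mulrA _ (tau `^ (1 - p)) g).
rewrite ge0_integralD//; last 4 first.
- by move=> t _; rewrite lee_fin.
- exact: mEF.
- by move=> t _; rewrite adde_ge0// mule_ge0// lee_fin.
- by apply: emeasurable_funD; apply: measurable_funeM => //; exact: mEF.
rewrite ge0_integralD//; last 4 first.
- by move=> t _; rewrite mule_ge0// lee_fin.
- by apply: measurable_funeM; exact: mEF.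
- by move=> t _; rewrite mule_ge0// lee_fin.
- exact: measurable_funeM.
rewrite !ge0_integralZl_EFin//; last 2 first.
- by move=> t _; rewrite lee_fin.
- exact: mEF.
rewrite -integral_mkcondr.
have -> : eps * g = eps / 3 * g + (eps / 3 * g + eps / 3 * g) by field.
rewrite !EFinD; apply: leeD; [|apply: leeD].
- have mone : measurable_fun [set: T] (fun=> 1 : R) by exact: measurable_cst.
  have := C0P _ T nu D (fun=> 1) (fun t => (1 + enorm (pr t)) / s) (A * s `^ (n%:R - 1)) mD mone.
  have mrs : measurable_fun [set: T] (fun t => (1 + enorm (pr t)) / s) by exact: measurable_funM.
  move=> /(_ mrs (fun=> ler01) (fun t _ => divr_gt0 (r0 t) s0)).
  rewrite mulr_ge0 ?powR_ge0// => /(_ isT) h.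
  have {}h : (\int[nu]_(t in D) (1 * bipower b1 b3 ((1 + enorm (pr t)) / s))%:E <=
      (A * s `^ (n%:R - 1) * C0)%:E)%E.
    apply: h => r r0'; rewrite integral_cst//; last first.
      apply: measurableI => //.
      exact: measurable_sublevel mrs.
    rewrite mul1e.
    have -> : [set t | (1 + enorm (pr t)) / s < r] = [set t | 1 + enorm (pr t) < r * s].
      by apply/seteqP; split=> t /=; rewrite ltr_pdivrMr.
    apply: le_trans (growth _) _; first by rewrite mulr_gt0.
    by rewrite lee_fin powRM ?(ltW s0) ?(ltW r0')// -mulrA [s `^ _ * _]mulrC.
  have -> : (\int[nu]_(t in D) (delta t)%:E = (tau * g * s `^ (1 - n%:R))%:E *
      \int[nu]_(t in D) (1 * bipower b1 b3 ((1 + enorm (pr t)) / s))%:E)%E.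
    rewrite -ge0_integralZl_EFin//.
    - by apply: eq_integral => t _; rewrite -EFinM mul1r.
    - by move=> t _; rewrite lee_fin mul1r bipower_ge0.
    - by apply: mEF; apply: measurable_funM => //; exact: mbip.
  apply: (le_trans (lee_wpmul2l _ h)); first by rewrite lee_fin.
  rewrite -EFinM lee_fin.
  have -> : tau * g * s `^ (1 - n%:R) * (A * s `^ (n%:R - 1) * C0) =
     (tau * (A * C0)) * g * (s `^ (1 - n%:R) * s `^ (n%:R - 1)) by ring.
  have -> : s `^ (1 - n%:R) * s `^ (n%:R - 1) = 1.
    by have [S ->] := gt0_expR s0; rewrite !powR_expR -expRD -expR0; congr expR; ring.
  rewrite mulr1 ler_wpM2r ?(ltW g0)// /tau mulrAC ler_pdivrMr; last first.
    by rewrite ltr_wpDl// mulr_ge0.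
  by rewrite ler_wpM2l ?lerDl// divr_ge0// ltW.
- apply: (le_trans (lee_wpmul2l _ (M1P s Mx1))); first by rewrite lee_fin.
  rewrite -EFinM lee_fin /c1 [leLHS](_ : _ = eps / 3 * g * (k1 / k1)); last by ring.
  by rewrite divff ?gt_eqF// mulr1.
- have := C3P _ T nu (D `&` nb) energy (fun t => dist x (pr t) / x.2)
    (e' * (x.2 / s) `^ (p * n%:R - alpha)).
  have mdx : measurable_fun [set: T] (fun t => dist x (pr t) / x.2) by exact: measurable_funM.
  move=> /(_ (measurableI _ _ mD mnb) measurable_energy mdx energy_ge0) h.
  have {}h : (\int[nu]_(t in D `&` nb) (energy t * bipower ((n%:R - 2) * p) (n%:R * p) (dist x (pr t) / x.2))%:E <=
      (e' * (x.2 / s) `^ (p * n%:R - alpha) * C3)%:E)%E.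
    apply: h.
    - by move=> t [_ /andP[d0 _]]; rewrite divr_gt0.
    - by rewrite mulr_ge0 ?powR_ge0// ltW.
    - move=> r r0'.
      have mball rho : measurable [set t | dist x (pr t) < rho].
        exact: measurable_sublevel md.
      (* sparseness is assumed only up to the radius [s / 2] of [nb] *)
      pose rho := Num.min (r * x.2) (s / 2).
      apply: (@le_trans _ _ (\int[nu]_(t in D `&` [set t | (dist x (pr t) < rho)%R]) (energy t)%:E)%E).
        apply: ge0_subset_integral => //.
        + apply: measurableI; first exact: measurableI.
          exact: measurable_sublevel mdx.
        + exact: measurableI.
        + by apply: measurable_funTS; apply/measurable_EFinP; exact: measurable_energy.
        + by move=> t _; rewrite lee_fin energy_ge0.
        + move=> t [[Dt /andP[_ ds]] /=]; rewrite ltr_pdivrMr// => dr; split=> //=.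
          by rewrite lt_min dr.
      apply: (le_trans (sparse _ _ _)).
      + by rewrite lt_min mulr_gt0// divr_gt0.
      + by rewrite ge_min lexx orbT.
      + rewrite lee_fin -(mulrA e') ler_wpM2l ?(ltW e'0)//.
        rewrite -powRM ?divr_ge0 ?(ltW x0) ?(ltW s0) ?(ltW r0')//.
        have N0 : 0 <= p * n%:R - alpha by have := n3'; have := p1; nra.
        rewrite ge0_ler_powR// ?nnegrE ?divr_ge0 ?mulr_ge0 ?invr_ge0 ?le_min ?mulr_ge0 ?divr_ge0 ?(ltW x0) ?(ltW s0) ?(ltW r0')//.
        by rewrite mulrAC ler_wpM2r ?invr_ge0 ?(ltW s0)// mulrC ge_min lexx.
  apply: (le_trans (lee_wpmul2l _ h)); first by rewrite lee_fin.
  rewrite -EFinM lee_fin /c2.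
  have one : (s / x.2) `^ (p * n%:R - alpha) * (x.2 / s) `^ (p * n%:R - alpha) = 1.
    rewrite -powRM ?divr_ge0 ?(ltW x0) ?(ltW s0)//.
    by rewrite mulrA divfK ?gt_eqF// divff ?gt_eqF// powR1.
  have regroup (b c f a e k : R) : b * c * f * (a * e * k) = b * k * a * c * (f * e).
    by ring.
  rewrite regroup one mulr1 ler_wpM2r ?(ltW g0)// /e' mulrA ler_pdivrMr; last first.
    by rewrite mulr_gt0// ltr_wpDl.
  rewrite mulrC ler_wpM2l ?divr_ge0 ?(ltW eps0)//.
  by rewrite ler_wpM2l ?lerDl// ltW.
Qed.

End estimate.


(** * The exceptional balls *)

Section covering.
Context (R : realType) (n : nat) (m : {measure set (point R n) -> \bar R}).
Variable N : R.
Hypotheses (N0 : 0 < N) (moo : (m [set: point R n] < +oo)%E).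

(** A candidate is a center together with a relative radius: the radii
    themselves are unbounded, and the quantity to be summed is a power of the
    relative one. *)
Let ball (c : point R n * R) := eball c.1 (c.2 * enorm c.1).

Let cand : set (point R n * R) := [set c | [/\ halfspace R n c.1, 0 < c.2,
  c.2 <= 2^-1 & ((c.2 `^ N)%:E < m (ball c))%E]].

Let free (U : set (point R n)) : set (point R n * R) :=
  [set c | cand c /\ ball c `&` U = set0].

Let greedy U : set (point R n * R) :=
  [set c | free U c /\ forall c', free U c' -> c'.2 <= 2 * c.2].

Let c0 : point R n * R := (([tuple 0 | i < n.-1], 0), 0).

Let step (U : set (point R n)) := U `|` ball (xget c0 (greedy U)).

Let used k := iter k step set0.

Let chosen k := xget c0 (greedy (used k)).

Let J : set nat := [set k | greedy (used k) !=set0].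

Let greedy_ex U : free U !=set0 -> greedy U !=set0.
Proof.
move=> [c Fc]; pose E := [set t | exists2 c, free U c & c.2 = t].
have Es : has_sup E.
  split; first by exists c.2; exists c.
  by exists 2^-1 => _ [c' [[_ _ ? _] _] <-].
have supE : c.2 <= sup E by apply: ub_le_sup; [exact: Es.2|exists c].
have c20 : 0 < c.2 by case: Fc => -[].
have sup0 : 0 < sup E by apply: lt_le_trans supE.
have [_ [c' Fc' <-] c's] := sup_adherent (divr_gt0 sup0 (ltr0n R 2)) Es.
exists c'; split=> // c'' Fc''.
have : c''.2 <= sup E by apply: ub_le_sup; [exact: Es.2|exists c''].
by lra.
Qed.

Let chosenP k : J k -> greedy (used k) (chosen k).
Proof. by move=> [c gc]; exact: xgetPex (ex_intro _ c gc). Qed.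

Let used_chosen k : used k.+1 = used k `|` ball (chosen k).
Proof. by []. Qed.

Let used_le k l : (k <= l)%N -> used k `<=` used l.
Proof.
move=> /subnK <-; elim: (l - k)%N => [//|i IH]; rewrite addSn.
by rewrite used_chosen => x /IH; left.
Qed.

Let ball_used k l : (k < l)%N -> ball (chosen k) `<=` used l.
Proof. by move=> kl x bx; apply: (used_le kl); rewrite used_chosen; right. Qed.

Let trivJ : trivIset J (ball \o chosen).
Proof.
apply/trivIsetP => k l Jk Jl; wlog kl : k l Jk Jl / (k < l)%N => [wl kl|_].
  have [lt|lt|] := ltngtP k l; first exact: wl.
    by rewrite setIC; apply: wl => //; rewrite eq_sym.
  by move/eqP; rewrite (negbTE kl).
have [[_ disj] _] := chosenP Jl.
apply/seteqP; split=> // x [bk bl]; rewrite -disj; split=> //.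
exact: ball_used bk.
Qed.

Let sum_chosen X : finite_set X -> X `<=` J ->
  (\sum_(k \in X) ((chosen k).2 `^ N)%:E <= m [set: point R n])%E.
Proof.
move=> fX XJ; apply: (@le_trans _ _ (\sum_(k \in X) m (ball (chosen k)))%E).
  by apply: lee_fsum => // k /XJ /chosenP[[[_ _ _ /ltW]]].
rewrite -(measure_fin_bigcup m fX (F := ball \o chosen)).
- by apply: le_measure; rewrite ?inE//; apply: fin_bigcup_measurable => // k _;
  exact: measurable_eball.
- by move=> k l Xk Xl; apply: trivJ; exact: XJ.
- by move=> k _; exact: measurable_eball.
Qed.

(** Both balls have relative radius at most [1/2], so that [|x| <= 3 |x'|] for
    their centers; the radius of the first one is then at most [2 * 3] times
    that of the second one, whence the factor [7]. *)
Let ballI c c' : halfspace R n c.1 -> c.2 <= 2^-1 -> c'.2 <= 2^-1 ->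
  0 < c.2 -> 0 < c'.2 ->
  ball c `&` ball c' !=set0 -> c.2 <= 2 * c'.2 ->
  eball c'.1 (7 * (c'.2 * enorm c'.1)) c.1.
Proof.
move=> Hc c12 c'12 cp c'p [z [bz b'z]] cc'; move: bz b'z.
rewrite /ball !eballE /= => bz b'z.
have t1 := dist_triangle z c'.1 c.1; rewrite (dist_sym z) in t1.
have t2 := enorm_le_dist c.1 c'.1; rewrite dist_sym in t2.
have e0 := enorm_ge0 c.1; have e0' := enorm_ge0 c'.1.
have h1 : c.2 * enorm c.1 <= 2^-1 * enorm c.1 by rewrite ler_wpM2r.
have h2 : c'.2 * enorm c'.1 <= 2^-1 * enorm c'.1 by rewrite ler_wpM2r.
have h3 : enorm c.1 <= 3 * enorm c'.1 by lra.
have h4 : c.2 * enorm c.1 <= (2 * c'.2) * (3 * enorm c'.1).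
  by apply: ler_pM => //; exact: ltW.
by lra.
Qed.

(** Greedy selection by decreasing relative radius: the selected balls are
    disjoint, so their relative radii tend to zero, and hence every candidate
    meets a selected one at least half as large. *)
Lemma sparse_off_balls : exists (J : set nat) (xs : nat -> point R n)
    (rho : nat -> R), [/\ forall j, J j -> halfspace R n (xs j) /\ 0 < rho j,
  (\esum_(j in J) (rho j `^ N / enorm (xs j) `^ N)%:E < +oo)%E &
  forall x, halfspace R n x -> ~ (\bigcup_(j in J) eball (xs j) (rho j)) x ->
  forall r, 0 < r -> r <= enorm x / 2 ->
    (m (eball x r) <= ((r / enorm x) `^ N)%:E)%E].
Proof.
have hs0 (x : point R n) : halfspace R n x -> 0 < enorm x.
  move=> x0; apply: lt_le_trans (height_le_enorm x).
  by rewrite normr_gt0 gt_eqF.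
exists J, (fun k => (chosen k).1), (fun k => 7 * ((chosen k).2 * enorm (chosen k).1)).
split.
- by move=> k /chosenP[[[Hc tc _ _] _] _]; split=> //; rewrite !mulr_gt0// hs0.
- apply: (@le_lt_trans _ _ ((7 `^ N)%:E * m [set: point R n])%E); last first.
    by rewrite lte_mul_pinfty// lee_fin powR_ge0.
  apply: ge_ereal_sup => _ [X [fX XJ] <-].
  rewrite (eq_fsbigr (fun k => (7 `^ N)%:E * ((chosen k).2 `^ N)%:E)%E); last first.
    move=> k; rewrite inE => /XJ /chosenP[[[Hc tc _ _] _] _].
    have e0 := hs0 _ Hc.
    rewrite -EFinM; congr EFin; rewrite mulrA powRM ?mulr_ge0 ?(ltW tc) ?(ltW e0)//.
    by rewrite mulfK ?gt_eqF ?powR_gt0// powRM// ltW.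
  rewrite -ge0_mule_fsumr//; last by move=> k; rewrite lee_fin powR_ge0.
  by rewrite lee_wpmul2l ?lee_fin ?powR_ge0// sum_chosen.
move=> x Hx xoff r r0 rx; rewrite leNgt; apply/negP => big.
have ex := hs0 x Hx.
pose c : point R n * R := (x, r / enorm x).
have cr : c.2 * enorm c.1 = r by rewrite /c/= divfK// gt_eqF.
have cc : cand c.
  split=> //=; first by rewrite divr_gt0.
    by rewrite ler_pdivrMr// mulrC.
  by rewrite /ball cr.
have cpos : 0 < c.2 by case: cc.
have [[k0 k0P]|/forallNP none] := pselect (exists k, ball c `&` used k !=set0).
  have [k /asboolP kP kmin] := @ex_minnP (fun k => `[< ball c `&` used k !=set0 >])
    (ex_intro _ k0 (asboolT k0P)).
  case: k kP kmin => [[z [_ []]]//|k [z [bz]]] kP kmin.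
  have Fc : free (used k) c.
    split=> //; apply: contrapT => /eqP/set0P h.
    by have := kmin k (asboolT h); rewrite ltnn.
  have Jk : J k by apply: greedy_ex; exists c.
  have [[[Hk tk tk2 _] _] gk] := chosenP Jk.
  apply: xoff; exists k => //.
  apply: (@ballI c (chosen k)) => //; [by case: cc| |exact: gk].
  exists z; split=> //; case: kP => // zu.
  by case: Fc => _ /seteqP[/(_ z) + _]; case.
have Fc k : free (used k) c by split=> //; apply: contrapT => /eqP/set0P; exact: none.
have allJ k : J k by apply: greedy_ex; exists c.
(* all selected balls have relative radius at least [c.2 / 2], which
   contradicts the convergence of the sum *)
pose v := (c.2 / 2) `^ N; have v0 : 0 < v by rewrite powR_gt0// divr_gt0.
have bound K : (v *+ K <= fine (m [set: point R n])).
  rewrite -lee_fin fineK; last by rewrite ge0_fin_numE// measure_ge0.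
  apply: le_trans (@sum_chosen `I_K (finite_II K) _); last by move=> k _; exact: allJ.
  rewrite -fsbig_ord/= (_ : v *+ K = \sum_(i < K) v)%R; last first.
    by rewrite sumr_const card_ord.
  rewrite -sumEFin; apply: lee_sum => i _; rewrite lee_fin.
  have [[[_ tk _ _] _] /(_ c (Fc i)) h] := chosenP (allJ i).
  apply: ge0_ler_powR; rewrite ?nnegrE ?(ltW N0) ?(ltW tk)//.
    by rewrite divr_ge0// ltW.
  by rewrite ler_pdivrMr// mulrC.
have := bound (Num.trunc (fine (m [set: point R n]) / v)).+1.
rewrite -mulr_natr mulrC -ler_pdivlMr// leNgt => /negP; apply.
exact: truncnS_gt.
Qed.

End covering.

Section vanishing.
Context (R : realType) (n : nat) (m : {measure set (point R n) -> \bar R}).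
Variable N : R.
Hypotheses (N0 : 0 < N) (moo : (m [set: point R n] < +oo)%E).

(** To get a vanishing constant at infinity, the exceptional balls are built
    from a measure which is still finite, but infinitely larger than [m] at
    infinity. *)
Lemma vanishing_off_balls : exists (J : set nat) (xs : nat -> point R n)
    (rho : nat -> R), [/\ forall j, J j -> halfspace R n (xs j) /\ 0 < rho j,
  (\esum_(j in J) (rho j `^ N / enorm (xs j) `^ N)%:E < +oo)%E &
  forall e, 0 < e -> exists2 M, 0 < M &
  forall x, halfspace R n x -> ~ (\bigcup_(j in J) eball (xs j) (rho j)) x ->
  M <= enorm x -> forall r, 0 < r -> r <= enorm x / 2 ->
    (m (eball x r) <= (e * (r / enorm x) `^ N)%:E)%E].
Proof.
pose rr (y : point R n) : R := 1 + enorm y.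
have mrr : measurable_fun [set: point R n] rr.
  by apply: measurable_funD => //; exact: measurable_enorm.
have rr0 y : 0 < rr y by rewrite ltr_pwDl// enorm_ge0.
have one_oo : (\int[m]_(y in [set: point R n]) (1 : R)%:E < +oo)%E.
  by rewrite integral_cst// mul1e.
have pow0 (b : R) k : 0 < b -> 0 < b ^+ k by move=> b0; exact: exprn_gt0.
have tailk k := integral_tail measurableT (measurable_cst (1 : R)) mrr
  (fun=> ler01) one_oo (pow0 4^-1 k ltac:(by rewrite invr_gt0)).
pose M k := projT1 (cid2 (tailk k)).
have M0 k : 0 < M k by rewrite /M; case: cid2.
pose tail k := [set: point R n] `\` [set y | rr y < M k].
have mtail k : measurable (tail k).
  apply: measurableD => //.
  exact: measurable_sublevel mrr.
have tail_le k : (m (tail k) <= (4^-1 ^+ k)%:E)%E.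
  rewrite /tail /M; case: cid2 => Mk /= _; rewrite integral_cst ?mul1e//.
  apply: measurableD => //.
  exact: measurable_sublevel mrr.
have pow2 k : 0 <= (2 : R) ^+ k by rewrite exprn_ge0.
pose mk k : {measure set (point R n) -> \bar R} :=
  mscale (NngNum (pow2 k)) (mrestr m (mtail k)).
pose m' : {measure set (point R n) -> \bar R} := mseries mk 0.
have mkE k B : mk k B = ((2 ^+ k)%:E * m (B `&` tail k))%E by [].
have m'oo : (m' [set: point R n] < +oo)%E.
  apply: (@le_lt_trans _ _ 2%:E); last exact: ltry.
  apply: lime_le; first by apply: is_cvg_nneseries => k _ _; exact: measure_ge0.
  apply: nearW => K.
  apply: (@le_trans _ _ (\sum_(0 <= k < K) (1 * 2^-1 ^+ k)%:E)%E).
    apply: lee_sum => k _; rewrite mkE setTI.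
    apply: (le_trans (lee_wpmul2l _ (tail_le k))); first by rewrite lee_fin.
    by rewrite -EFinM lee_fin mul1r -exprMn (_ : 2 * 4^-1 = 2^-1 :> R)//; field.
  rewrite sumEFin lee_fin.
  have h0 : 0 < (2^-1 : R) by rewrite invr_gt0.
  have := @geometric_le_lim R K 1 2^-1 ler01 h0.
  rewrite ger0_norm ?(ltW h0)// invf_lt1// ltr1n => /(_ isT) /le_trans; apply.
  by rewrite mul1r (_ : 1 - 2^-1 = 2^-1 :> R) ?invrK//; field.
have [J [xs [rho [Jxs Joo off]]]] := sparse_off_balls N0 m'oo.
exists J, xs, rho; split=> // e e0.
(* [m'] is at least [2^k m] where [1 + |y| >= M k] *)
have [k ke] : exists k, 2^-1 ^+ k <= e.
  have /cvgrPdist_lt/(_ _ e0)[k _ kP] := @cvg_geometric R 1 2^-1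
    (ltac:(by rewrite ger0_norm ?invr_ge0// invf_lt1// ltr1n)).
  exists k; have := kP k (leqnn k).
  rewrite /= sub0r normrN mul1r ger0_norm ?exprn_ge0 ?invr_ge0//.
  exact: ltW.
exists (2 * M k) => [|x Hx xoff Mx r r0 rx]; first by rewrite mulr_gt0.
have := off x Hx xoff r r0 rx.
have inc : eball x r `<=` tail k.
  move=> y; rewrite eballE => /= xy; split=> //= yM.
  have := enorm_le_dist x y; move: yM; rewrite /rr; lra.
have le1 : ((2 ^+ k)%:E * m (eball x r) <= m' (eball x r))%E.
  apply: (@le_trans _ _ (mk k (eball x r))).
    by rewrite mkE (setIidl inc).
  apply: le_trans (nneseries_lim_ge k.+1 _) => //.
  by rewrite big_nat_recr//= leeDr// sume_ge0.
move=> /(le_trans le1).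
rewrite -(@lee_pmul2l _ (2^-1 ^+ k)%:E) ?lte_fin ?pow0 ?invr_gt0//.
rewrite muleA -EFinM -exprMn mulVf// expr1n mul1e => /le_trans; apply.
by rewrite -EFinM lee_fin ler_wpM2r ?powR_ge0.
Qed.

Lemma null_center (x : point R n) (e s : R) : 0 < e -> 0 < s ->
  (forall r, 0 < r -> r <= s / 2 ->
     (m (eball x r) <= (e * (r / s) `^ N)%:E)%E) -> m [set x] = 0%E.
Proof.
move=> e0 s0 sparse; apply/eqP; rewrite eq_le measure_ge0 andbT.
apply/lee_addgt0Pr => eta eta0; rewrite add0e.
pose r := s * Num.min 2^-1 ((eta / e) `^ N^-1).
have pw0 : 0 < (eta / e) `^ N^-1 by rewrite powR_gt0 ?divr_gt0.
have min0 : 0 < Num.min 2^-1 ((eta / e) `^ N^-1) by rewrite lt_min pw0 invr_gt0 ltr0n.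
have r0 : 0 < r by rewrite mulr_gt0.
have rs : r <= s / 2 by rewrite ler_wpM2l ?(ltW s0)// ge_min lexx.
apply: (@le_trans _ _ (m (eball x r))).
  apply: le_measure; rewrite ?inE; [exact: measurable_point|exact: measurable_eball|].
  by move=> _ ->; rewrite eballE /= distxx.
apply: le_trans (sparse r r0 rs) _; rewrite lee_fin -ler_pdivlMl// [leRHS]mulrC.
rewrite /r [s * _]mulrC mulfK ?gt_eqF//.
have {2}-> : eta / e = ((eta / e) `^ N^-1) `^ N.
  by rewrite -powRrM mulVf ?gt_eqF// powRr1// divr_ge0// ltW.
by rewrite ge0_ler_powR ?nnegrE ?(ltW N0) ?(ltW min0) ?powR_ge0// ge_min lexx orbT.
Qed.

End vanishing.


(** * Integrals of arbitrary nonnegative functions *)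

Section lower_integral.
Context d (T : measurableType d) (R : realType) (nu : {measure set T -> \bar R}).

Import HBNNSimple.

(** The integral of a nonnegative function is defined as a lower integral, hence
    monotone with no measurability hypothesis. *)
Lemma le_lower_integral (D : set T) (f g : T -> \bar R) :
  (forall t, D t -> 0 <= f t)%E -> (forall t, D t -> f t <= g t)%E ->
  (\int[nu]_(t in D) f t <= \int[nu]_(t in D) g t)%E.
Proof.
move=> f0 fg; have g0 t : D t -> (0 <= g t)%E.
  by move=> Dt; exact: le_trans (f0 _ Dt) (fg _ Dt).
rewrite !(integral_mkcond D) !ge0_integralTE//; last 2 first.
- by move=> t; exact: erestrict_ge0.
- by move=> t; exact: erestrict_ge0.
apply: le_ereal_sup => _ [h hf <-]; exists h => // t.
by apply: le_trans (hf t) _; exact: lee_restrict.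
Qed.

(** [H] is the supremum of a maximizing sequence of simple functions below [G]:
    replacing [H] by the maximum of [S] and [H] cannot increase its integral. *)
Lemma measurable_envelope (G : T -> R) : (forall t, 0 <= G t) ->
  (\int[nu]_t (G t)%:E < +oo)%E ->
  exists H : T -> R, [/\ measurable_fun [set: T] H,
    forall t, 0 <= H t <= G t &
    forall S : T -> R, measurable_fun [set: T] S ->
      (forall t, 0 <= S t <= G t) -> {ae nu, forall t, S t <= H t}].
Proof.
move=> G0 Goo; set I := (\int[nu]_t (G t)%:E)%E.
have I0 : (0 <= I)%E by apply: integral_ge0 => t _; rewrite lee_fin.
have finI : I \is a fin_num by rewrite ge0_fin_numE.
have ex k : exists h : {nnsfun T >-> R}, (forall t, h t <= G t) /\
    (I - (k.+1%:R^-1)%:E < sintegral nu h)%E.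
  pose SS := [set sintegral nu h |
    h in [set h : {nnsfun T >-> R} | forall x, ((h x)%:E <= (G x)%:E)%E]].
  have IE : I = ereal_sup SS by rewrite /I ge0_integralTE.
  have k0 : 0 < (k.+1%:R^-1 : R) by rewrite invr_gt0.
  have finS : ereal_sup SS \is a fin_num by rewrite -IE.
  have [_ [h hG <-] hI] := ub_ereal_sup_adherent k0 finS.
  exists h; split; last by rewrite IE.
  by move=> t; rewrite -lee_fin; exact: hG.
pose h k := projT1 (cid (ex k)).
have hG k t : h k t <= G t by rewrite /h; case: cid => ? [].
have hI k : (I - (k.+1%:R^-1)%:E < sintegral nu (h k))%E.
  by rewrite /h; case: cid => ? [].
have bd t : has_ubound (range (fun k => h k t)).
  by exists (G t) => _ [k _ <-]; exact: hG.
pose H t := sups (fun k => h k t) 0%N.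
have mH : measurable_fun [set: T] H.
  by apply: measurable_fun_sups => // t _; exact: bd.
have hH k t : h k t <= H t.
  apply: ub_le_sup; last by exists k.
  by exists (G t) => _ [j _ <-]; exact: hG.
have HG t : H t <= G t.
  by apply: ge_sup; [exists (h 0%N t); exists 0%N|move=> _ [k _ <-]; exact: hG].
have H0 t : 0 <= H t by apply: le_trans (hH 0%N t).
have IH : (I <= \int[nu]_t (H t)%:E)%E.
  apply/lee_addgt0Pr => e e0.
  have [k ke] : exists k : nat, k.+1%:R^-1 <= e.
    by exists (Num.trunc e^-1); rewrite invf_ple ?posrE// ltW// truncnS_gt.
  have := hI k; rewrite -integralT_nnsfun lteBlDr// => /ltW /le_trans; apply.
  apply: leeD; last by rewrite lee_fin.
  by apply: le_lower_integral => t _; rewrite lee_fin.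
exists H; split=> // [t|S mS SG]; first by rewrite H0 HG.
pose E t := Num.max (S t) (H t) - H t.
have E0 t : 0 <= E t by rewrite subr_ge0 le_max lexx orbT.
have mE : measurable_fun [set: T] E.
  by apply: measurable_funB => //; exact: measurable_maxr.
have EH : (\int[nu]_t (E t)%:E + \int[nu]_t (H t)%:E <= I)%E.
  rewrite -ge0_integralD//; try exact/measurable_EFinP.
  - apply: le_lower_integral => t _; rewrite -EFinD lee_fin.
      exact: addr_ge0 (E0 t) (H0 t).
    by rewrite /E subrK ge_max HG andbT; case/andP: (SG t).
  - by move=> t _; rewrite lee_fin.
  - by move=> t _; rewrite lee_fin.
have intE : (\int[nu]_t `|(E t)%:E| = 0)%E.
  under eq_integral do rewrite gee0_abs ?lee_fin//.
  apply/eqP; rewrite eq_le integral_ge0 ?andbT; last by move=> t _; rewrite lee_fin.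
  have := le_trans EH IH.
  have finH : (\int[nu]_t (H t)%:E)%E \is a fin_num.
    rewrite ge0_fin_numE; last by apply: integral_ge0 => t _; rewrite lee_fin.
    apply: le_lt_trans Goo; apply: le_lower_integral => t _; rewrite lee_fin//.
  by rewrite -[leRHS]add0e leeD2rE.
have mE' : measurable_fun [set: T] (EFin \o E) by exact/measurable_EFinP.
have := (@ae_eq_integral_abs _ _ _ nu _ measurableT _ mE').1 intE.
apply: filterS => t /(_ Logic.I) /= [] /eqP; rewrite /E subr_eq0 => /eqP <-.
by rewrite le_max lexx.
Qed.

(** Replacing [|f|] by a suitable measurable function decreases none of its
    lower integrals against measurable weights: [F^p / W] is the envelope of
    [|f|^p / W], and a simple function [s <= k |f|] gives the competitor
    [(s / k)^p / W]. Applied to the boundary data, which are measurable only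
    for the completed algebra, it yields Borel ones. *)
Lemma measurable_minorant (f W : T -> R) (p : R) : 0 < p ->
  measurable_fun [set: T] W -> (forall t, 0 < W t) ->
  (\int[nu]_t (`|f t| `^ p / W t)%:E < +oo)%E ->
  exists F : T -> R, [/\ measurable_fun [set: T] F, forall t, 0 <= F t,
    (\int[nu]_t (F t `^ p / W t)%:E < +oo)%E &
    forall k : T -> R, measurable_fun [set: T] k -> (forall t, 0 <= k t) ->
      (\int[nu]_t (k t * `|f t|)%:E <= \int[nu]_t (k t * F t)%:E)%E].
Proof.
move=> p0 mW W0 foo.
have fW0 t : 0 <= `|f t| `^ p / W t by rewrite divr_ge0 ?powR_ge0// ltW.
have [H [mH HG Hae]] := measurable_envelope fW0 foo.
have H0 t : 0 <= H t by case/andP: (HG t).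
have pK x : 0 <= x -> (x `^ p^-1) `^ p = x.
  by move=> x0; rewrite -powRrM mulVf ?gt_eqF// powRr1.
pose F t := (H t * W t) `^ p^-1.
have FpE t : F t `^ p = H t * W t by rewrite /F pK// mulr_ge0// ltW.
have mF : measurable_fun [set: T] F.
  exact: (measurableT_comp (measurable_powR p^-1)) (measurable_funM mH mW).
exists F; split=> [|t||k mk k0].
- exact: mF.
- exact: powR_ge0.
- apply: le_lt_trans foo; apply: le_lower_integral => t _; rewrite lee_fin.
    by rewrite divr_ge0 ?powR_ge0// ltW.
  by rewrite FpE mulfK ?gt_eqF//; case/andP: (HG t).
rewrite [leLHS]ge0_integralTE; last by move=> t; rewrite lee_fin mulr_ge0.
apply: ge_ereal_sup => _ [s /= sk <-]; rewrite -integralT_nnsfun.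
pose S t := (s t * k t `^ (-1)) `^ p / W t.
have mS : measurable_fun [set: T] S.
  apply: measurable_funM.
    apply: (measurableT_comp (measurable_powR p)); apply: measurable_funM => //.
    exact: (measurableT_comp (measurable_powR (-1))).
  rewrite (_ : (fun t => _) = fun t => W t `^ (-1)).
    exact: (measurableT_comp (measurable_powR (-1))).
  by apply/funext => t; rewrite powR_inv1// ltW.
have SG t : 0 <= S t <= `|f t| `^ p / W t.
  rewrite /S divr_ge0 ?powR_ge0 ?(ltW (W0 t))//= ler_pM2r ?invr_gt0//.
  rewrite ge0_ler_powR// ?nnegrE ?(ltW p0) ?mulr_ge0 ?powR_ge0//.
  have := sk t; rewrite lee_fin.
  have [->|kt] := eqVneq (k t) 0.
    by rewrite powR0 ?mulr0// oppr_eq0.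
  have {}kt : 0 < k t by rewrite lt_def kt k0.
  by rewrite powR_inv1 ?(ltW kt)// ler_pdivrMr// mulrC.
apply: ae_ge0_le_integral => //.
- by move=> t _; rewrite lee_fin.
- by apply/measurable_EFinP.
- by move=> t _; rewrite lee_fin mulr_ge0// powR_ge0.
- by apply/measurable_EFinP; exact: measurable_funM.
have := Hae S mS SG; apply: filterS => t; rewrite /S => SH _; rewrite lee_fin.
have := sk t; rewrite lee_fin.
have [->|kt _] := eqVneq (k t) 0; first by rewrite !mul0r.
have {}kt : 0 < k t by rewrite lt_def kt k0.
move: SH; rewrite ler_pdivrMr// -FpE powR_inv1 ?(ltW kt)// => SH.
rewrite mulrC -ler_pdivrMr//.
have st : 0 <= s t / k t by rewrite divr_ge0// ltW.
have F0 : 0 <= F t by exact: powR_ge0.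
have {}pK x : 0 <= x -> (x `^ p) `^ p^-1 = x.
  by move=> x0; rewrite -powRrM mulfV ?gt_eqF// powRr1.
rewrite -(pK _ st) -(pK _ F0).
by rewrite ge0_ler_powR// ?nnegrE ?powR_ge0// invr_ge0 ltW.
Qed.

(** For a possibly non-measurable [g], whose integral is the difference of two
    lower integrals. *)
Lemma le_abs_integral (D : set T) (g : T -> \bar R) (b : R) :
  (\int[nu]_(t in D) `|g t| <= b%:E)%E -> (`|\int[nu]_(t in D) g t| <= b%:E)%E.
Proof.
move=> gb; rewrite integralE.
have pos : (0 <= \int[nu]_(t in D) g^\+ t <= b%:E)%E.
  rewrite integral_ge0/=; last by move=> t _; exact: funepos_ge0.
  apply: le_trans gb; apply: le_lower_integral => t _; first exact: funepos_ge0.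
  by rewrite funeposE ge_max lee_abs abse_ge0.
have neg : (0 <= \int[nu]_(t in D) g^\- t <= b%:E)%E.
  rewrite integral_ge0/=; last by move=> t _; exact: funeneg_ge0.
  apply: le_trans gb; apply: le_lower_integral => t _; first exact: funeneg_ge0.
  by rewrite funenegE ge_max -[X in (_ <= X)%E]abseN lee_abs ?abseN abse_ge0.
move: pos neg; move: (integral _ _ _) (integral _ _ _) => x y.
case: x => [x| |]; case: y => [y| |]; rewrite ?leye_eq ?leeNy_eq ?andbF//=.
rewrite !lee_fin => /andP[x0 xb] /andP[y0 yb].
by rewrite ler_norml; apply/andP; split; lra.
Qed.

End lower_integral.


(** * Energies as measures on the half space *)

Section image_density.
Context d d' (T : measurableType d) (S : measurableType d') (R : realType).
Variables (nu : {measure set T -> \bar R}) (D : set T) (phi : T -> R)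
  (pr : T -> S).

(** The proofs are arguments so that the measure structure can be inferred. *)
Definition image_density (mD : measurable D)
    (mphi : measurable_fun [set: T] phi) (phi0 : forall t, 0 <= phi t)
    (mpr : measurable_fun [set: T] pr) (A : set S) : \bar R :=
  (\int[nu]_(t in D `&` pr @^-1` A) (phi t)%:E)%E.

Variables (mD : measurable D) (mphi : measurable_fun [set: T] phi)
  (phi0 : forall t, 0 <= phi t) (mpr : measurable_fun [set: T] pr).

Local Notation m := (image_density mD mphi phi0 mpr).

Let m0 : m set0 = 0%E.
Proof. by rewrite /image_density preimage_set0 setI0 integral_set0. Qed.

Let m_ge0 A : (0 <= m A)%E.
Proof. by apply: integral_ge0 => t _; rewrite lee_fin. Qed.

Let m_sigma_additive : semi_sigma_additive m.
Proof.
move=> F mF tF mUF; rewrite /image_density preimage_bigcup setI_bigcupr.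
rewrite ge0_integral_bigcup//=.
- by apply: (@is_cvg_nneseries _ _ xpredT 0%N) => i _ _; exact: (m_ge0 (F i)).
- move=> i; apply: measurableI => //.
  by rewrite -[X in measurable X]setTI; exact: mpr.
- by apply: measurable_funTS; exact/measurable_EFinP.
- by move=> t _; rewrite lee_fin.
- apply/trivIsetP => i j _ _ ij.
  move/trivIsetP : tF => /(_ i j Logic.I Logic.I ij) FF.
  by apply/seteqP; split=> // t [[_ /= Fi] [_ /= Fj]]; have : set0 (pr t) by rewrite -FF.
Qed.

HB.instance Definition _ := isMeasure.Build _ _ _ m m0 m_ge0 m_sigma_additive.

End image_density.

(** * Growth of the boundary and interior measures *)

Section lebesgue_growth.
Context (R : realType).

Definition cube (m : nat) (r : R) : set (m.-tuple R) :=
  [set t | forall i, `|tnth t i| < r].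

Arguments cube : clear implicits.

Lemma measurable_cube m r : measurable (cube m r).
Proof.
have -> : cube m r = \bigcap_(i in [set: 'I_m]) (fun t : m.-tuple R => tnth t i) @^-1` `]- r, r[.
  apply/seteqP; split=> t h; first by move=> i _ /=; rewrite in_itv/= -ltr_norml; exact: h.
  by move=> i; have := h i Logic.I; rewrite /= in_itv/= -ltr_norml.
apply: fin_bigcap_measurable => // i _.
by rewrite -[X in measurable X]setTI; exact: measurable_tnth.
Qed.

Lemma lebesgue_cube m r : 0 < r -> (lebesgue R m (cube m r) <= ((2 * r) ^+ m)%:E)%E.
Proof.
move=> r0; elim: m => [|m IH].
  rewrite /= /dirac expr0 indicE lee_fin.
  by case: (_ \in _).
have -> : lebesgue R m.+1 (cube m.+1 r) =
    (@lebesgue_measure R \x lebesgue R m)%E (@tcons R m @^-1` cube m.+1 r) by [].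
have -> : @tcons R m @^-1` cube m.+1 r = `]- r, r[ `*` cube m r.
  apply/seteqP; split=> [[a t] h|[a t] [/= ar tr] i].
    split=> [|i] /=.
      by have := h ord0; rewrite tnth0/= in_itv/= -ltr_norml.
    by have := h (lift ord0 i); rewrite !(tnth_nth 0)/=.
  case: (unliftP ord0 i) => [j ->|->].
    by have := tr j; rewrite !(tnth_nth 0)/=.
  by rewrite tnth0/=; move: ar; rewrite in_itv/= -ltr_norml.
rewrite product_measure1E//; last exact: measurable_cube.
rewrite exprS EFinM; apply: lee_pmul => //.
rewrite [X in (X <= _)%E](_ : _ = (@lebesgue_measure R) `]- r, r[)//.
rewrite lebesgue_measure_itv/= lte_fin ifT; last by lra.
by rewrite -EFinD lee_fin; lra.
Qed.

Lemma lebesgue_growth (n : nat) (r : R) : (0 < n)%N -> 0 < r ->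
  (lebesgue R n.-1 ([set: n.-1.-tuple R] `&`
     [set t | (1 + enorm ((t, 0) : point R n) < r)%R]) <=
   (2 ^+ n.-1 * r `^ (n%:R - 1))%:E)%E.
Proof.
move=> n0 r0.
have -> : (n%:R - 1 : R) = n.-1%:R by rewrite -{1}(prednK n0) -natr1 addrK.
rewrite powR_mulrn ?(ltW r0)// -exprMn setTI.
apply: le_trans (lebesgue_cube n.-1 r0).
apply: le_measure; rewrite ?inE.
- rewrite -[X in measurable X]setTI (_ : [set t | _] =
    (fun t => 1 + enorm ((t, 0) : point R n)) @^-1` `]-oo, r[).
    have : measurable_fun [set: n.-1.-tuple R] (fun t => 1 + enorm ((t, 0) : point R n)).
      apply: measurable_funD => //.
      by apply: (measurableT_comp (@measurable_enorm R n)); exact: measurable_fun_pair.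
    by apply.
  by apply/seteqP; split=> t /=; rewrite in_itv.
- exact: measurable_cube.
- move=> t /= tr i; apply: le_lt_trans tr.
  rewrite ler_wpDl// /enorm expr0n addr0 -sqrtr_sqr ler_wsqrtr// (bigD1 i)//= lerDl.
  by apply: sumr_ge0 => j _; exact: sqr_ge0.
Qed.

End lebesgue_growth.


Section interior_growth.
Context (R : realType) (n : nat) (mu : {measure set (point R n) -> \bar R}).

Lemma finite_growth : (0 < n)%N ->
  (\int[mu]_(y in halfspace R n) ((1 + enorm y) ^+ n.-1)^-1%:E < +oo)%E ->
  exists2 A : R, 0 <= A & forall r, 0 < r ->
  (mu (halfspace R n `&` [set y | (1 + enorm y < r)%R]) <=
   (A * r `^ (n%:R - 1))%:E)%E.
Proof.
move=> n0 muoo; set I := (integral _ _ _) in muoo.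
have mH := @measurable_halfspace R n.
have w0 (y : point R n) : 0 < 1 + enorm y by rewrite ltr_pwDl// enorm_ge0.
have mw : measurable_fun [set: point R n] (fun y => 1 + enorm y).
  by apply: measurable_funD => //; exact: measurable_enorm.
have f0 (y : point R n) : (0 <= ((1 + enorm y) ^+ n.-1)^-1%:E)%E.
  by rewrite lee_fin invr_ge0 exprn_ge0// ltW.
have I0 : (0 <= I)%E by apply: integral_ge0 => y _; exact: f0.
have finI : I \is a fin_num by rewrite ge0_fin_numE.
exists (fine I) => [|r r0]; first exact: fine_ge0.
set E := _ `&` _.
have mE : measurable E.
  apply: measurableI => //.
  exact: measurable_sublevel mw.
have mf : measurable_fun [set: point R n] (fun y => ((1 + enorm y) ^+ n.-1)^-1%:E).
  apply/measurable_EFinP.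
  rewrite (_ : (fun y => _) = fun y : point R n => (1 + enorm y) `^ (- n.-1%:R)).
    exact: (measurableT_comp (measurable_powR _)).
  by apply/funext => y; rewrite powR_invn// ltW.
have -> : (n%:R - 1 : R) = n.-1%:R by rewrite -{1}(prednK n0) -natr1 addrK.
rewrite powR_mulrn ?(ltW r0)// mulrC EFinM fineK//.
apply: (@le_trans _ _ (\int[mu]_(y in E) ((r ^+ n.-1)%:E *
   ((1 + enorm y) ^+ n.-1)^-1%:E))%E).
  rewrite -[X in (X <= _)%E]mul1e -integral_cst//.
  apply: ge0_le_integral => //.
  - by apply: measurable_funeM; exact: measurable_funTS.
  - move=> y [_ /= yr]; rewrite -EFinM lee_fin ler_pdivlMr ?exprn_gt0// mul1r.
    by rewrite lerXn2r ?nnegrE ?(ltW r0) ?(ltW (w0 y))// ltW.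
rewrite ge0_integralZl_EFin//; last 2 first.
- exact: measurable_funTS.
- by rewrite exprn_ge0// ltW.
apply: lee_wpmul2l; first by rewrite lee_fin exprn_ge0// ltW.
apply: ge0_subset_integral => //; first exact: measurable_funTS.
exact: subIsetl.
Qed.

End interior_growth.


(** * The Poisson integral and the Green potential *)

Section potentials.
Context (R : realType) (n : nat).

Lemma poisson_integral_le (f F : bdry R n -> R) (x : point R n) (b : R) :
  0 < x.2 -> measurable_fun [set: bdry R n] F -> (forall t, 0 <= F t) ->
  (forall k : bdry R n -> R, measurable_fun [set: bdry R n] k ->
     (forall t, 0 <= k t) ->
     (\int[lebesgue R n.-1]_t (k t * `|f t|)%:E <=
      \int[lebesgue R n.-1]_t (k t * F t)%:E)%E) ->
  (\int[lebesgue R n.-1]_t (halfspace_kernel x (t, 0) * F t)%:E <= b%:E)%E ->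
  (`|poisson_integral f x| <= (`|2 / omega R n| * b)%:E)%E.
Proof.
move=> x0 mF F0 minor KF; apply: le_abs_integral.
have mK : measurable_fun [set: bdry R n] (fun t => halfspace_kernel x ((t, 0) : point R n)).
  apply: (measurableT_comp (@measurable_halfspace_kernel R n x)).
  exact: measurable_fun_pair.
pose k (t : bdry R n) := `|2 / omega R n| * halfspace_kernel x ((t, 0) : point R n).
apply: (@le_trans _ _ (\int[lebesgue R n.-1]_t (k t * `|f t|)%:E)%E).
  apply: le_lower_integral => t _; first exact: abse_ge0.
  rewrite /= lee_fin poisson_kernel// normrM (normrM (2 / omega R n)).
  by rewrite (ger0_norm (halfspace_kernel_ge0 _ _)).
apply: le_trans (minor k _ _) _.
- exact: measurable_funM.
- by move=> t; rewrite mulr_ge0 ?halfspace_kernel_ge0.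
under eq_integral do rewrite /k -mulrA EFinM.
rewrite ge0_integralZl_EFin//.
- by rewrite EFinM; apply: lee_wpmul2l => //; rewrite lee_fin.
- by move=> t _; rewrite lee_fin mulr_ge0 ?halfspace_kernel_ge0.
- by apply/measurable_EFinP; exact: measurable_funM.
Qed.

(** The Green function is infinite at its pole [x], which therefore must not be
    charged. *)
Lemma green_potential_le (mu : {measure set (point R n) -> \bar R})
    (x : point R n) (b : R) : (3 <= n)%N -> 0 < x.2 -> mu [set x] = 0%E ->
  (\int[mu]_(y in halfspace R n) (halfspace_kernel x y * y.2)%:E <= b%:E)%E ->
  (`|green_potential mu x| <= (4 * (n%:R - 2) * `|rconst R n| * b)%:E)%E.
Proof.
move=> n3 x0 mux Kb; apply: le_abs_integral.
have C0 : 0 <= 4 * (n%:R - 2) * `|rconst R n|.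
  by rewrite !mulr_ge0// subr_ge0 (ler_nat _ 2 n) ltnW.
set C := 4 * _ * _ in C0 *.
have mH := @measurable_halfspace R n.
have mK : measurable_fun (halfspace R n) (fun y => (halfspace_kernel x y * y.2)%:E).
  apply: measurable_funTS; apply/measurable_EFinP; apply: measurable_funM.
    exact: measurable_halfspace_kernel.
  exact: measurable_snd.
have K0 y : halfspace R n y -> (0 <= (halfspace_kernel x y * y.2)%:E)%E.
  by move=> Hy; rewrite lee_fin mulr_ge0 ?halfspace_kernel_ge0// ltW.
have mpt := measurable_point x.
apply: (@le_trans _ _ (\int[mu]_(y in halfspace R n)
   (C%:E * (halfspace_kernel x y * y.2)%:E + (cst +oo \_ [set x]) y))%E).
  apply: le_lower_integral => y Hy; first exact: abse_ge0.
  rewrite patchE; case: ifPn => [_|]; first by rewrite /= addey// leey.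
  rewrite adde0 notin_setE/= => /eqP yx; rewrite -EFinM.
  by apply: green_le_kernel => //; rewrite eq_sym.
rewrite ge0_integralD//; last 4 first.
- by move=> y Hy; rewrite mule_ge0 ?lee_fin//; exact: K0.
- exact: measurable_funeM.
- by move=> y _; rewrite patchE; case: ifP => // _; exact: leey.
- apply: measurable_funTS; apply/(measurable_restrictT _ _).1 => //.
rewrite -integral_mkcondr integral_cst; last exact: measurableI.
rewrite (_ : mu _ = 0)%E ?mule0 ?adde0; last first.
  apply/eqP; rewrite eq_le measure_ge0 andbT -mux.
  by apply: le_measure; rewrite ?inE//; exact: measurableI.
by rewrite ge0_integralZl_EFin// [leRHS]EFinM; apply: lee_wpmul2l.
Qed.

End potentials.

Lemma fine_conjugate (R : realType) (p a : R) (q : \bar R) : 1 <= p ->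
  (p%:E^-1 + q^-1 = 1)%E -> fine (a%:E / q)%E = a * (1 - p^-1).
Proof.
move=> p1; have p0 : p != 0 by rewrite gt_eqF// (lt_le_trans ltr01).
rewrite inver (negbTE p0); case: (q^-1)%E => [r| |] //= [] pr.
by rewrite (_ : r = 1 - p^-1)//; rewrite -pr; lra.
Qed.

Theorem theorem2 (R : realType) (n : nat) (p : R) (q : \bar R) (gamma alpha : R)
    (f : n.-1.-tuple R -> R)
    (mu : {measure set (n.-1.-tuple R * R) -> \bar R}) :
  (3 <= n)%N ->
  1 <= p ->
  (p%:E^-1 + q^-1 = 1)%E ->
  (1 < p -> - ((n%:R - 1) * (p - 1)) < gamma < n%:R - 1 + p) ->
  (p = 1 -> 0 < gamma <= n%:R) ->
  0 < alpha < 2 ->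
  lebesgue_measurable f ->
  (\int[lebesgue R n.-1]_y'
     (`|f y'| `^ p / (1 + bnorm y') `^ gamma)%:E < +oo)%E ->
  (\int[mu]_(y in halfspace R n)
     (y.2 `^ p / (1 + enorm y) `^ gamma)%:E < +oo)%E ->
  (\int[mu]_(y in halfspace R n)
     ((1 + enorm y) ^+ n.-1)^-1%:E < +oo)%E ->
  let u := (fun x => poisson_integral f x + green_potential mu x)%E in
  let g := fun x : n.-1.-tuple R * R =>
    x.2 `^ (1 - alpha / p) *
    enorm x `^ (gamma / p + fine ((n%:R - 1)%:E / q)%E - n%:R + alpha / p) in
  exists (J : set nat) (xs : nat -> n.-1.-tuple R * R) (rho : nat -> R),
    [/\ forall j, J j -> halfspace R n (xs j) /\ 0 < rho j,
        (\esum_(j in J)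
           (rho j `^ (p * n%:R - alpha) /
            enorm (xs j) `^ (p * n%:R - alpha))%:E < +oo)%E &
        forall eps : R, 0 < eps -> exists2 M : R, 0 < M &
          forall x, halfspace R n x ->
            ~ (\bigcup_(j in J) eball (xs j) (rho j)) x ->
            M <= enorm x ->
            (`| u x | <= (eps * g x)%:E)%E].
Proof.
move=> n3 p1 pq gamma_p gamma_1 alpha02 _ foo muoo muoo' u g.
have n0 : (0 < n)%N by apply: leq_trans n3.
have n3' : 3 <= n%:R :> R by rewrite ler_nat.
have p0 : 0 < p by apply: lt_le_trans p1.
have /andP[al0 al2] := alpha02.
have N0 : 0 < p * n%:R - alpha by nra.
have gE x : g x = majorant n%:R p alpha gamma x.2 (enorm x).
  by rewrite /g (fine_conjugate _ p1 pq).
have mH := @measurable_halfspace R n.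
pose pr1 (t : n.-1.-tuple R) : n.-1.-tuple R * R := (t, 0).
have mpr1 : measurable_fun [set: n.-1.-tuple R] pr1 by exact: measurable_fun_pair.
have mW : measurable_fun [set: n.-1.-tuple R] (fun t => (1 + bnorm t) `^ gamma).
  rewrite (_ : (fun t => _) = fun t => (1 + enorm (pr1 t)) `^ gamma).
    apply: (measurableT_comp (measurable_powR gamma)).
    apply: measurable_funD => //.
    exact: (measurableT_comp (@measurable_enorm R n)).
  by apply/funext => t; rewrite enorm_bdry.
have W0 (t : n.-1.-tuple R) : 0 < (1 + bnorm t) `^ gamma :> R.
  by rewrite powR_gt0// ltr_pwDl// sqrtr_ge0.
have [F [mF F0 Foo minor]] := measurable_minorant p0 mW W0 foo.
pose en1 := energy p gamma pr1 F.
have en1oo : (\int[lebesgue R n.-1]_(t in setT) (en1 t)%:E < +oo)%E.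
  by rewrite /en1 /energy; under eq_integral do rewrite enorm_bdry.
have m_en1 : measurable_fun [set: n.-1.-tuple R] en1 by exact: measurable_energy.
have en10 t : 0 <= en1 t by exact: energy_ge0.
have grow1 := fun r => @lebesgue_growth R n r n0.
pose pr2 (y : n.-1.-tuple R * R) := y.
have mpr2 : measurable_fun [set: n.-1.-tuple R * R] pr2 by exact: measurable_id.
have msnd : measurable_fun [set: n.-1.-tuple R * R] (@snd (n.-1.-tuple R) R).
  exact: measurable_snd.
pose en2 := energy p gamma pr2 snd.
have m_en2 : measurable_fun [set: n.-1.-tuple R * R] en2 by exact: measurable_energy.
have en20 y : 0 <= en2 y by exact: energy_ge0.
have [A A0 grow2] := finite_growth n0 muoo'.
(* the energies are added up so that one family of balls serves for both
   potentials *)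
pose m1 := image_density (lebesgue R n.-1) measurableT m_en1 en10 mpr1.
pose m2 := image_density mu mH m_en2 en20 mpr2.
pose m := measure_add m1 m2.
have moo : (m [set: n.-1.-tuple R * R] < +oo)%E.
  rewrite /m measure_addE /m1 /m2 /= /image_density !preimage_setT !setIT.
  by apply: lte_add_pinfty.
have [J [xs [rho [Jxs Joo sparse]]]] := vanishing_off_balls N0 moo.
exists J, xs, rho; split=> // eps eps0.
pose C1 := `|2 / omega R n|; pose C2 := 4 * (n%:R - 2) * `|rconst R n|.
have C10 : 0 <= C1 by exact: normr_ge0.
have C20 : 0 <= C2 by rewrite !mulr_ge0// subr_ge0 (le_trans _ n3')// ler_nat.
have share C : 0 <= C -> 0 < eps / 2 / (C + 1) /\ C * (eps / 2 / (C + 1)) <= eps / 2.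
  move=> CC; have C1' : 0 < C + 1 by rewrite ltr_wpDl.
  split; first by rewrite !divr_gt0.
  by rewrite mulrA ler_pdivrMr// mulrC ler_wpM2l ?lerDl// divr_ge0// ltW.
have [eps10 eps1C] := share C1 C10; have [eps20 eps2C] := share C2 C20.
have [e1 e10 [M1 M10 est1]] := @potential_estimate R n p alpha gamma n3 p1 alpha02
  gamma_p gamma_1 _ _ (lebesgue R n.-1) setT pr1 F (2 ^+ n.-1) measurableT mpr1 mF
  (fun t _ => F0 t) (exprn_ge0 _ (ler0n R 2)) en1oo grow1 _ eps10.
have [e2 e20 [M2 M20 est2]] := @potential_estimate R n p alpha gamma n3 p1 alpha02
  gamma_p gamma_1 _ _ mu (halfspace R n) pr2 snd A mH mpr2 msnd
  (fun t Ht => ltW Ht) A0 muoo grow2 _ eps20.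
have e0 : 0 < Num.min e1 e2 by rewrite lt_min e10.
have [M3 M30 sparse3] := sparse _ e0.
exists (M1 + M2 + M3) => [|x x0 xoff Mx]; first by rewrite !addr_gt0.
have [Mx1 Mx2 Mx3] : [/\ M1 <= enorm x, M2 <= enorm x & M3 <= enorm x].
  by move: Mx; clear -M10 M20 M30; split; lra.
have sp := sparse3 x x0 xoff Mx3.
have s0 : 0 < enorm x := lt_le_trans M10 Mx1.
have sp1 r : 0 < r -> r <= enorm x / 2 ->
    (m1 (eball x r) <= (e1 * (r / enorm x) `^ (p * n%:R - alpha))%:E)%E.
  move=> r0 rx; apply: (@le_trans _ _ (m (eball x r))).
    by rewrite /m measure_addE leeDl.
  apply: le_trans (sp r r0 rx) _; rewrite lee_fin ler_wpM2r ?powR_ge0//.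
  by rewrite ge_min lexx.
have sp2 r : 0 < r -> r <= enorm x / 2 ->
    (m2 (eball x r) <= (e2 * (r / enorm x) `^ (p * n%:R - alpha))%:E)%E.
  move=> r0 rx; apply: (@le_trans _ _ (m (eball x r))).
    by rewrite /m measure_addE leeDr.
  apply: le_trans (sp r r0 rx) _; rewrite lee_fin ler_wpM2r ?powR_ge0//.
  by rewrite ge_min lexx orbT.
have mux : mu [set x] = 0%E.
  have := null_center N0 e20 s0 sp2; rewrite /m2 /= /image_density /pr2 preimage_id.
  have Hx : halfspace R n `&` [set x] = [set x].
    by apply/setIidr => _ ->.
  rewrite Hx (eq_integral (cst (en2 x)%:E)); last by move=> y; rewrite inE => ->.
  rewrite integral_cst; last exact: measurable_point.
  move/eqP; rewrite mule_eq0 => /orP[/eqP[]|/eqP//].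
  have : 0 < en2 x.
    by rewrite /en2 /energy divr_gt0// powR_gt0// ltr_pwDl// enorm_ge0.
  by move=> /[swap] ->; rewrite ltxx.
have v1 : (`|poisson_integral f x| <=
    (C1 * (eps / 2 / (C1 + 1) * g x))%:E)%E.
  apply: (poisson_integral_le x0 mF F0 minor).
  rewrite gE; apply: est1 => //.
  move=> r r0 rx; have := sp1 r r0 rx.
  by rewrite /m1 /image_density eballE.
have h1 : (`|green_potential mu x| <=
    (C2 * (eps / 2 / (C2 + 1) * g x))%:E)%E.
  apply: green_potential_le => //.
  rewrite gE; apply: est2 => //.
  move=> r r0 rx; have := sp2 r r0 rx.
  by rewrite /m2 /image_density eballE.
apply: le_trans (lee_abs_add _ _) _; apply: (le_trans (leeD v1 h1)).
have g0 : 0 <= g x by rewrite gE ltW// majorant_gt0.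
rewrite -EFinD lee_fin (mulrA C1) (mulrA C2) -mulrDl ler_wpM2r//.
by rewrite [leRHS]splitr lerD.
Qed.
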